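(* Let $X$ be a polynomial vector field of degree $d$ on $\mathbb{C}^2$, let $f$ be an invariant algebraic curve of $X$, and let $g$ be a derivative of $f$. Suppose that $\exp(g/f)$ is an exponential factor of $X$ and that the curves $g=0$ and $f=0$ are non-singular and have normal crossings with themselves and the line at infinity. Then the geometric multiplicity satisfies $\mu_g(X,f)\ge2$.
   Context: A polynomial vector field of degree $d$ on $\mathbb{C}^2$ is $X=a\,\frac{\partial}{\partial x}+b\,\frac{\partial}{\partial y}$ with $a,b\in\mathbb{C}[x,y]$ and $\max(\deg a,\deg b)=d$; it acts by $X(f)=a f_x+b f_y$. An algebraic curve $\{f=0\}$ (or simply $f$), $f\in\mathbb{C}[x,y]$, is invariant by $X$ if $X(f)/f$ is a polynomial. For $f,g\in\mathbb{C}[x,y]$, $e=\exp(g/f)$ is an exponential factor of $X$ if $X(e)/e$ is a polynomial of degree at most $d-1$. Curves are called distinct if pairwise they have no common factors; convergence means convergence of the coefficients of the polynomials involved. The line at infinity is the complement of $\mathbb{C}^2$ in the complex projective plane. Derivative: let $X_t$, $t\in(-\epsilon,\epsilon)$, be an analytic $1$-parameter family of vector fields of degree $d$ with $X_0=X$ such that, for each $t\neq0$, $X_t$ has two distinct invariant algebraic curves $f_t^{(1)},f_t^{(2)}$. Assume that $f_t^{(1)},f_t^{(2)}\to f$ as $t\to0$, and that for some positive integer $r$ $$\lim_{t\to0}\frac{f_t^{(2)}-f_t^{(1)}}{t^j}=0\ \ (j=1,\ldots,r-1),\qquad \lim_{t\to0}\frac{f_t^{(2)}-f_t^{(1)}}{t^r}\neq0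 .$$ Then the polynomial given by the last limit is called a derivative of $f$. Geometric multiplicity: $f$ has $l$-geometric multiplicity $\mu_{g,l}(X,f)=m$ if $m$ is the largest number (possibly $+\infty$) for which there exists a sequence of vector fields $X_k$ of degree $d$ converging to $X$ such that each $X_k$ has $m$ distinct invariant algebraic curves of degree at most $l$, all converging to $f$ as $k\to\infty$. The geometric multiplicity is $\mu_g(X,f)=\lim_{l\to\infty}\mu_{g,l}(X,f)$ (possibly $+\infty$). *)

(* Defs.v *)
From HB Require Import structures.
From mathcomp Require Import all_boot all_order all_algebra.
From mathcomp Require Import all_classical all_reals all_analysis.
From mathcomp Require Import complex.
(* The notations of mpoly clash with those of MathComp-Analysis. *)
From mathcomp Require Import -(notations) mpoly.

Set Implicit Arguments.
Unset Strict Implicit.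
Unset Printing Implicit Defensive.

Import Order.TTheory GRing.Theory Num.Theory numFieldNormedType.Exports.

Local Open Scope classical_set_scope.
Local Open Scope ring_scope.
Local Open Scope complex_scope.

(* The cast makes the topology of the modulus available on [R[i]]. *)
Definition CC (R : realType) : numClosedFieldType := R[i].

(* C[x,y], with x and y the variables of index 0 and 1; [mpoly.msize p] is
   1 + deg p, and 0 for p = 0. *)
Definition poly2 (R : realType) := mpoly 2 (CC R).

Definition point2 (R : realType) (x y : CC R) : 'I_2 -> CC R :=
  fun i => if i == 0 then x else y.

Definition eval2 (R : realType) (p : poly2 R) (x y : CC R) : CC R :=
  meval (point2 x y) p.

(* The pair (a, b) stands for a d/dx + b d/dy. *)
Definition vfield (R : realType) := (poly2 R * poly2 R)%type.

Definition vf_degree (R : realType) (d : nat) (X : vfield R) : Prop :=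
  maxn (mpoly.msize X.1) (mpoly.msize X.2) = d.+1.

Definition vf_app (R : realType) (X : vfield R) (f : poly2 R) : poly2 R :=
  X.1 * mderiv 0 f + X.2 * mderiv 1 f.

Definition invariant_curve (R : realType) (X : vfield R) (f : poly2 R) : Prop :=
  (1 < mpoly.msize f)%N /\ exists K : poly2 R, vf_app X f = K * f.

Definition distinct_curves (R : realType) (f1 f2 : poly2 R) : Prop :=
  forall h p q : poly2 R, f1 = h * p -> f2 = h * q -> (mpoly.msize h <= 1)%N.

(* Coefficientwise convergence; no bound on the degrees is imposed. *)
Definition poly_cvg (R : realType) (T : Type) (F : set_system T)
    (h : T -> poly2 R) (l : poly2 R) : Prop :=
  forall m : multinom 2, mcoeff m (h t) @[t --> F] --> mcoeff m l.

Definition vf_cvg (R : realType) (T : Type) (F : set_system T)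
    (Y : T -> vfield R) (X : vfield R) : Prop :=
  poly_cvg F (fun t => (Y t).1) X.1 /\ poly_cvg F (fun t => (Y t).2) X.2.

Definition cexp (R : realType) (z : CC R) : CC R :=
  let: a +i* b := z in (expR a * cos b) +i* (expR a * sin b).

(* X(e) for a function e on (an open subset of) C^2; [derive1] is taken over
   the field C, so these are complex partial derivatives. *)
Definition vf_app_fun (R : realType) (X : vfield R)
    (e : CC R -> CC R -> CC R) (x y : CC R) : CC R :=
  eval2 X.1 x y * derive1 (fun z : CC R => e z y) x
  + eval2 X.2 x y * derive1 (fun z : CC R => e x z) y.

Definition exp_quot (R : realType) (g f : poly2 R) (x y : CC R) : CC R :=
  cexp (eval2 g x y / eval2 f x y).

(* [msize L <= d] means deg L <= d - 1, i.e. L = 0 when d = 0. *)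
Definition exponential_factor (R : realType) (d : nat) (X : vfield R)
    (g f : poly2 R) : Prop :=
  f != 0 /\
  exists L : poly2 R, (mpoly.msize L <= d)%N /\
    forall x y : CC R, eval2 f x y != 0 ->
      vf_app_fun X (exp_quot g f) x y / exp_quot g f x y = eval2 L x y.

Definition analytic_at (R : realType) (c : R -> CC R) (t0 : R) : Prop :=
  exists (u : nat -> CC R) (rho : R), 0 < rho /\
    forall t : R, `|t - t0| < rho ->
      series (fun n => u n * ((t - t0)%:C : CC R) ^+ n) @ \oo --> c t.

Definition vf_analytic_at (R : realType) (Y : R -> vfield R) (t0 : R) : Prop :=
  forall m : multinom 2,
    analytic_at (fun t => mcoeff m (Y t).1) t0 /\
    analytic_at (fun t => mcoeff m (Y t).2) t0.

(* g is a derivative of the curve f of the vector field X of degree d. *)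
Definition is_curve_derivative (R : realType) (d : nat) (X : vfield R)
    (f g : poly2 R) : Prop :=
  exists (eps : R) (Y : R -> vfield R) (f1 f2 : R -> poly2 R) (r : nat),
    let quot (j : nat) (t : R) : poly2 R :=
      ((t%:C : CC R) ^+ j)^-1 *: (f2 t - f1 t) in
    [/\ 0 < eps,
        Y 0 = X,
        (forall t, `|t| < eps -> vf_degree d (Y t) /\ vf_analytic_at Y t) &
        (forall t, `|t| < eps -> t != 0 ->
          [/\ invariant_curve (Y t) (f1 t), invariant_curve (Y t) (f2 t) &
              distinct_curves (f1 t) (f2 t)])] /\
    [/\ poly_cvg 0^' f1 f, poly_cvg 0^' f2 f & (0 < r)%N] /\
    [/\ (forall j, (0 < j < r)%N -> poly_cvg 0^' (quot j) 0),
        poly_cvg 0^' (quot r) g & g != 0].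

Definition approx_by_curves (R : realType) (d l : nat) (X : vfield R)
    (f : poly2 R) (m : nat) : Prop :=
  exists (Y : nat -> vfield R) (h : nat -> 'I_m -> poly2 R),
    [/\ (forall k, vf_degree d (Y k)),
        vf_cvg \oo Y X,
        (forall k i, invariant_curve (Y k) (h k i)
                     /\ (mpoly.msize (h k i) <= l.+1)%N),
        (forall k i j, i != j -> distinct_curves (h k i) (h k j)) &
        (forall i, poly_cvg \oo (fun k => h k i) f)].

(* The set of admissible m contains 0 and is downward closed, so its supremum
   in the extended reals is its largest element, or +oo. *)
Definition mu_gl (R : realType) (d l : nat) (X : vfield R) (f : poly2 R)
    : \bar R :=
  ereal_sup [set (m%:R)%:E | m in approx_by_curves d l X f].

Definition mu_g (R : realType) (d : nat) (X : vfield R) (f : poly2 R)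
    : \bar R :=
  limn (fun l => mu_gl d l X f).

Definition nonsingular_curve (R : realType) (f : poly2 R) : Prop :=
  forall x y : CC R, eval2 f x y = 0 ->
    (eval2 (mderiv 0 f) x y != 0) || (eval2 (mderiv 1 f) x y != 0).

Definition poly3 (R : realType) := mpoly 3 (CC R).

Definition var3 (R : realType) (i : 'I_3) : poly3 R := mpolyX (CC R) (mnm1 i).

(* z ^ deg(p) * p(x/z, y/z): an equation of the projective closure of p = 0.
   The line at infinity is z = 0, i.e. [var3 R 2%:R]. *)
Definition homogenize (R : realType) (p : poly2 R) : poly3 R :=
  \sum_(m <- msupp p)
    mcoeff m p *: (var3 R 0 ^+ m 0 * var3 R 1 ^+ m 1
                   * var3 R 2%:R ^+ ((mpoly.msize p).-1 - mdeg m)).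

Definition gradient3 (R : realType) (F : poly3 R) (p : 'rV[CC R]_3)
    : 'rV[CC R]_3 :=
  \row_i meval (p 0) (mderiv i F).

(* Normal crossings in the projective plane of the curves F = 0, F in Fs
   (homogeneous): at each point the differentials of those equations that
   vanish there are linearly independent.  By Euler's relation the gradients
   at a common zero p <> 0 lie in the plane of covectors vanishing at p, which
   is the cotangent space at [p] of the projective plane; hence the condition
   says that the curves through [p] are smooth there, at most two in number,
   and transverse. *)
Definition normal_crossings (R : realType) (Fs : seq (poly3 R)) : Prop :=
  forall p : 'rV[CC R]_3, p != 0 ->
    free [seq gradient3 F p | F <- Fs & meval (p 0) F == 0].

(* Main.v *)
Require Import Defs.
From HB Require Import structures.
From mathcomp Require Import all_boot all_order all_algebra.
From mathcomp Require Import all_classical all_reals all_analysis.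
From mathcomp Require Import complex ring lra zify.
From mathcomp Require Import -(notations) mpoly ssrcomplements.

Set Implicit Arguments.
Unset Strict Implicit.
Unset Printing Implicit Defensive.

Import Order.TTheory GRing.Theory Num.Theory numFieldNormedType.Exports.

Local Open Scope ring_scope.

(** Write [X f = K f].  The hypothesis on the exponential factor amounts to
    [X g = K g + L f] with [deg L < d].  Suppose that a vector field [Z] of
    degree at most [d] satisfies [Z f = M f] and [Z g = N g] with [N - M = L].
    Then, for every number [e], the vector field [X + e Z] leaves invariant both
    [f], with cofactor [K + e M], and [f + e g], with cofactor
    [K + e (M + L)].  These two curves have no common factor if [f] and [g] have
    none, and both tend to [f] with [e], so that the multiplicity is at least 2
    ([approx_of_logarithmic]).

    Such a [Z] ([logarithmic_field]) is sought in the form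
    [Z = f g Y + c g (f_x d/dy - f_y d/dx)].  The difference of its cofactors is
    [c J + f Y(g) - g Y(f)], where [J = f_x g_y - f_y g_x].  It equals [L] when
    [(c, - Y_y, Y_x)] is the vector of coefficients of an expression of [L] as a
    combination of the minors of the matrix with rows [u = (f, f_x, f_y)] and
    [v = (g, g_x, g_y)], and the degree of [Z] is at most [d] when
    [deg c <= d - deg f - deg g + 1] and [deg Y <= d - deg f - deg g]
    ([cofactor_in_minors]).

    Without the degrees, this is commutative algebra with unit ideals.  As [f]
    is smooth, the entries of [u] generate the unit ideal by the
    Nullstellensatz, and so do [f], [g] and [J], as the curves are transverse.
    The vector [(- K, X_x, X_y)] is orthogonal to [u], hence is a cross product
    [w x u], and [L f = det (w, u, v)].  Modulo [f] and [g] this determinant is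
    [w_0 J], hence [w_0] lies in the ideal of [f] and [g]; subtraction of
    multiples of [u] and [v] from [w] makes it vanish.  Then [f] divides
    [g (w_1 f_y - w_2 f_x)], hence [w_1 f_y - w_2 f_x], so that
    [(w_1, w_2)] and the quotient form once more a vector orthogonal to [u],
    that is a cross product with [u], which allows the division of
    [det (w, u, v)] by [f].

    The degrees are controlled at infinity.  If a solution of one of these
    linear equations has a greater degree than its right-hand side requires, its
    leading form solves the homogeneous equation for the leading forms.  Since
    these have no common zero on the line at infinity, by transversality, the
    homogeneous equation has only the obvious solutions ([proportional],
    [combination_of_rows]), and one of them can be subtracted to lower the degree
    ([reduce_cross], [reduce_det]).  When [deg f < deg g], division by [f]
    leaves coefficients of too large a degree, and a last reduction uses that
    the leading forms of the minors have no common zero; this follows from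
    Euler's relation. *)

(** * The weak Nullstellensatz in two variables, one polynomial being monic *)

Section PlaneNullstellensatz.
Variable F : closedFieldType.
Implicit Types p H : {poly {poly F}}.

(** [s] is the norm of [E = 1 + (x - x0) H], the determinant of multiplication
    by [E] on the free module of polynomials in [y] modulo [p]: it lies in the
    ideal of [p] and [E] because of the adjugate matrix, and its value at [x0]
    is 1 because the matrix is the identity there. *)
Lemma norm_in_ideal p H (x0 : F) : p \is monic ->
  exists (s : {poly F}) (a b : {poly {poly F}}),
    s.[x0] = 1 /\ s%:P = a * p + b * (1 + ('X - x0%:P) *: H).
Proof.
move=> pm; set c := 'X - x0%:P; set E := 1 + _.
have [m szp] : exists m, size p = m.+1.
  by exists (size p).-1; rewrite prednK // size_poly_gt0 monic_neq0.
case: m szp => [|m] szp.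
  have /size_poly1P[e _ pe] : size p == 1%N by rewrite szp.
  have -> : p = 1 by move/monicP: pm; rewrite pe lead_coefC => ->.
  by exists 1, 1, 0; rewrite hornerC mulr1 mul0r addr0 polyC1.
pose r j := Pdiv.Ring.rmodp (H * 'X^j) p.
pose q j := Pdiv.Ring.rdivp (H * 'X^j) p.
have qr j : H * 'X^j = q j * p + r j by apply: Pdiv.RingMonic.rdivp_eq.
have szr j : (size (r j) <= m.+1)%N.
  by rewrite -ltnS -szp Pdiv.Ring.ltn_rmodpN0 // monic_neq0.
pose M : 'M[{poly F}]_m.+1 := 1%:M + c *: \matrix_(j, i) (r j)`_i.
pose Y : 'cV[{poly {poly F}}]_m.+1 := \col_i 'X^i.
have MY j : (map_mx polyC M *m Y) j 0 = E * 'X^j - c *: (q j * p).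
  have rX : \sum_(i < m.+1) ((r j)`_i)%:P * 'X^i = r j.
    rewrite -[RHS](coefK (r j)) poly_def.
    rewrite (big_ord_widen _ (fun i => (r j)`_i *: 'X^i) (szr j)).
    rewrite [LHS](bigID (fun i : 'I_m.+1 => (i < size (r j))%N)) /=.
    rewrite [X in _ + X]big1 ?addr0 => [|i]; last first.
      by rewrite -leqNgt => /(nth_default 0) ->; rewrite mul0r.
    by apply: eq_bigr => i _; rewrite mul_polyC.
  rewrite map_mxD mulmxDl map_scalar_mx mul_scalar_mx rmorph1 scale1r map_mxZ.
  rewrite -scalemxAl !mxE.
  under eq_bigr => i _ do rewrite !mxE.
  rewrite rX /E mulrDl mul1r -addrA; congr (_ + _).
  by rewrite -[X in _ = X - _]scalerAl qr -scalerBr addrC addKr -mul_polyC.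
exists (\det M).
exists (\sum_j - (c *: (map_mx polyC (\adj M) 0 j * q j))).
exists (\sum_j map_mx polyC (\adj M) 0 j * 'X^j).
split.
  rewrite -horner_evalE -det_map_mx /M map_mxD map_scalar_mx rmorph1 map_mxZ /=.
  by rewrite /c horner_evalE !hornerE subrr scale0r addr0 det1.
have: (map_mx polyC (\adj M *m M) *m Y) 0 0 = (\det M)%:P.
  by rewrite mul_adj_mx map_scalar_mx mul_scalar_mx !mxE expr0 mulr1.
move <-; rewrite map_mxM -mulmxA mxE !mulr_suml -big_split /=.
apply: eq_bigr => j _; rewrite MY -!mul_polyC; ring.
Qed.

(** The norms of the polynomials [E] show that the trace of [I] on [F[x]] has no
    common zero.  A nonzero element of least degree of this trace is then a
    constant: otherwise its gcd with an element that does not vanish at one of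
    its roots would have a smaller degree. *)
Lemma unit_ideal_of_monic (I : {poly {poly F}} -> Prop) p :
    (forall a b, I a -> I b -> I (a + b)) -> (forall a b, I b -> I (a * b)) ->
    I p -> p \is monic ->
    (forall x0, exists2 E, I E & map_poly (horner_eval x0) E = 1) ->
  I 1.
Proof.
move=> ID IM Ip pm IE.
have IC x0 : exists2 s : {poly F}, I s%:P & s.[x0] = 1.
  have [E IEx Ex] := IE x0.
  have [H EH] : exists H, E = 1 + ('X - x0%:P) *: H.
    exists (map_poly (fun c => c %/ ('X - x0%:P)) (E - 1)).
    apply/polyP => i; rewrite coefD coefZ coef_map_id0 ?div0p // mulrC divpK.
      by rewrite coefB addrC subrK.
    rewrite dvdp_XsubCl coefB /root !hornerE.
    have /polyP/(_ i) := Ex; rewrite coef_map /= horner_evalE => ->.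
    by rewrite !coef1; case: (i == 0%N); rewrite ?hornerC subrr.
  have [s [a [b [s1 sE]]]] := norm_in_ideal H x0 pm.
  by exists s => //; rewrite sE -EH; apply: ID; apply: IM.
have [s0 Is0 s01] := IC 0.
have : s0 != 0 by apply: contra_eq_neq s01 => ->; rewrite horner0 eq_sym oner_eq0.
have [n] := ubnP (size s0).
elim: n s0 Is0 {s01} => // n IH s Is szs s0.
have [/eqP|sz1] := eqVneq (size s) 1%N.
  move=> /size_poly1P[c c0 sc].
  by have := IM c^-1%:P%:P _ Is; rewrite sc -!polyCM mulVf.
have /closed_rootP[x0 rx] := sz1.
have [s' Is' s'1] := IC x0.
have [[u v] /= /eqpf_eq[c c0 uv]] := Bezoutp s s'.
apply: (IH (gcdp s s')).
- have -> : gcdp s s' = c^-1 *: (u * s + v * s').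
    by rewrite uv scalerA mulVf // scale1r.
  rewrite -mul_polyC polyCM polyCD !polyCM; apply: (IM).
  by apply: ID; apply: IM.
- apply: (@leq_trans (size s)); last by rewrite -ltnS.
  rewrite ltn_neqAle dvdp_leq ?dvdp_gcdl // andbT.
  rewrite dvdp_size_eqp ?dvdp_gcdl //; apply/negP => /eqp_dvdl es.
  have : s %| s' by rewrite -es dvdp_gcdr.
  move=> /dvdpP[w s'w]; move: s'1 rx.
  by rewrite s'w hornerM => /eqP + /eqP => /[swap] ->; rewrite mulr0 eq_sym oner_eq0.
- by rewrite gcdp_eq0 negb_and s0.
Qed.

Lemma bezout3 (a b c : {poly F}) :
    (forall x, ~~ [&& a.[x] == 0, b.[x] == 0 & c.[x] == 0]) ->
  exists u v w, u * a + v * b + w * c = 1.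
Proof.
move=> nz.
have [[u v] /= /eqpf_eq[k k0 uv]] := Bezoutp a b.
have /Bezout_eq1_coprimepP[[s t] /= st] : coprimep (gcdp a b) c.
  apply/Pdiv.ClosedField.coprimepP => x; rewrite root_gcd => /andP[/eqP ax /eqP bx].
  by apply: contraNneq (nz x) => ->; rewrite ax bx !eqxx.
exists (s * k^-1%:P * u), (s * k^-1%:P * v), t.
rewrite -[RHS]st; congr (_ + _); rewrite -!mulrA -!mulrDr uv mul_polyC scalerA.
by rewrite mulVf // scale1r.
Qed.

(** On each line [x = x0] the three polynomials are coprime; a Bezout relation
    there is the restriction of an element of the ideal. *)
Lemma nullstellensatz_monic (p q r : {poly {poly F}}) : p \is monic ->
    (forall x y, ~~ [&& p.[y%:P].[x] == 0, q.[y%:P].[x] == 0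
                     & r.[y%:P].[x] == 0]) ->
  exists a b c, a * p + b * q + c * r = 1.
Proof.
move=> pm nz.
pose I e := exists a b c : {poly {poly F}}, a * p + b * q + c * r = e.
apply: (@unit_ideal_of_monic I p) => //.
- move=> _ _ [a [b [c <-]]] [a' [b' [c' <-]]].
  by exists (a + a'), (b + b'), (c + c'); ring.
- by move=> e _ [a [b [c <-]]]; exists (e * a), (e * b), (e * c); ring.
- by exists 1, 0, 0; rewrite mul1r !mul0r !addr0.
move=> x0; pose ev : {poly {poly F}} -> {poly F} := map_poly (horner_eval x0).
have evh e y : (ev e).[y] = e.[y%:P].[x0].
  by rewrite -[RHS]horner_evalE -horner_map /= horner_evalE hornerC.
have [y|a [b [c abc]]] := @bezout3 (ev p) (ev q) (ev r).
  by rewrite !evh nz.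
exists (map_poly polyC a * p + map_poly polyC b * q + map_poly polyC c * r).
  by exists (map_poly polyC a), (map_poly polyC b), (map_poly polyC c).
rewrite !rmorphD !rmorphM /= -/(ev p) -/(ev q) -/(ev r).
have evC e : map_poly (horner_eval x0) (map_poly polyC e) = e.
  by apply/polyP => i; rewrite !coef_map /= horner_evalE hornerC.
by rewrite !evC.
Qed.

End PlaneNullstellensatz.

(** * Total degree and leading forms in two variables *)

Lemma coefM_top (A : nzRingType) (p q : {poly A}) D E :
    (forall j, (D < j)%N -> p`_j = 0) -> (forall j, (E < j)%N -> q`_j = 0) ->
  (p * q)`_(D + E) = p`_D * q`_E.
Proof.
move=> p0 q0; rewrite coefM.
have ltD : (D < (D + E).+1)%N by rewrite ltnS leq_addr.
rewrite (bigD1 (Ordinal ltD)) //= addKn big1 ?addr0 // => i iD.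
have {}iD : nat_of_ord i != D by apply: contraNneq iD => iD; apply/eqP/val_inj.
have [lt|le] := ltnP i D; first by rewrite [X in _ * X]q0 ?mulr0 //; lia.
by rewrite p0 ?mul0r //; lia.
Qed.

Section TotalDegree.
Variable F : fieldType.
Local Notation P := (mpoly 2 F).
Implicit Types (p q : P) (m : multinom 2) (e : int).

Lemma forall_ord2 (Q : 'I_2 -> Prop) : Q 0 -> Q 1 -> forall i, Q i.
Proof.
move=> Q0 Q1 [[|[|//]] lti].
  by rewrite (_ : Ordinal lti = 0) //; apply: val_inj.
by rewrite (_ : Ordinal lti = 1) //; apply: val_inj.
Qed.

Lemma mdeg2 m : mdeg m = (m 0%R + m 1%R)%N.
Proof. by rewrite mdegE big_ord_recl big_ord1; congr (_ + m _)%N; apply: val_inj. Qed.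

Lemma multinom2_eq m m' : mdeg m = mdeg m' -> m 0 = m' 0 -> m = m'.
Proof.
rewrite !mdeg2 => d2 m0; apply/mnmP; apply: forall_ord2 => //.
by move: d2; rewrite m0 => /addnI.
Qed.

Definition graded_var (i : 'I_2) : {poly {poly F}} :=
  if i == 0 then 'X%:P * 'X else 'X.

(** The substitution [(x, y) -> (x t, t)].  The coefficient of [t ^ D] is the
    homogeneous part of degree [D], dehomogenized, so that total degree becomes
    the degree of a univariate polynomial. *)
Definition graded : P -> {poly {poly F}} :=
  mmap ((@polyC {poly F}) \o (@polyC F)) graded_var.

HB.instance Definition _ := GRing.RMorphism.on graded.

Lemma gradedX m : graded (mpolyX F m) = ('X^(m 0))%:P * 'X^(mdeg m).
Proof.
rewrite /graded mmapX /mmap1 big_ord_recl big_ord1 /graded_var /= mdeg2.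
have -> : lift ord0 ord0 = 1 :> 'I_2 by apply: val_inj.
by rewrite exprMn -mulrA -exprD -rmorphXn.
Qed.

Lemma gradedZ c p : graded (c *: p) = c%:P%:P * graded p.
Proof. exact: mmapZ. Qed.

Lemma coef_graded p D :
  (graded p)`_D = \sum_(m <- msupp p | mdeg m == D) mcoeff m p *: 'X^(m 0).
Proof.
rewrite {1}(mpolyE p) rmorph_sum /= coef_sum [RHS]big_mkcond /=.
apply: eq_bigr => m _; rewrite gradedZ gradedX mulrA -polyCM mul_polyC coefZ.
by rewrite coefXn eq_sym mul_polyC; case: eqP; rewrite ?mulr1 ?mulr0.
Qed.

Lemma mcoeff_graded p m : mcoeff m p = (graded p)`_(mdeg m)`_(m 0).
Proof.
rewrite coef_graded coef_sum.
have [mp|mp] := boolP (m \in msupp p).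
  rewrite big_mkcond (bigD1_seq m) //= ?msupp_uniq // eqxx big1 ?addr0.
    by rewrite coefZ coefXn eqxx mulr1.
  move=> m' m'm; case: eqP => // dm'; rewrite coefZ coefXn.
  by case: eqP => [m0|]; rewrite ?mulr0 //; case/eqP: m'm; apply: multinom2_eq.
rewrite memN_msupp_eq0 // big_seq_cond big1 // => m' /andP[m'p /eqP dm'].
rewrite coefZ coefXn; case: eqP => [m0|]; rewrite ?mulr0 //.
by case/negP: mp; rewrite (_ : m = m') //; apply: multinom2_eq.
Qed.

Lemma size_graded p : size (graded p) = mpoly.msize p.
Proof.
apply/eqP; rewrite eqn_leq; apply/andP; split.
  apply/leq_sizeP => j lej; rewrite coef_graded big_seq_cond big1 // => m.
  by move=> /andP[/msize_mdeg_lt + /eqP dm]; rewrite dm ltnNge lej.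
rewrite msizeE; apply/bigmax_leqP_seq => m + _.
rewrite mcoeff_msupp mcoeff_graded; apply: contraNltn.
by move=> /leq_sizeP -> //; rewrite coef0.
Qed.

(** Degree bounds are integers: the zero polynomial satisfies every bound, and it
    alone a negative one. *)
Definition deg_le e p := (mpoly.msize p == 0)%N || ((mpoly.msize p)%:Z <= e + 1).

(** The same convention for univariate polynomials. *)
Definition udeg_le e (a : {poly F}) := (size a == 0)%N || ((size a)%:Z <= e + 1).

(** The homogeneous part of degree [e], with [y] replaced by 1. *)
Definition top e p : {poly F} := if e is Posz D then (graded p)`_D else 0.

Lemma deg_leP e p : reflect (forall j : nat, e < j%:Z -> (graded p)`_j = 0) (deg_le e p).
Proof.
have szP n : (mpoly.msize p <= n)%N <-> forall j, (n <= j)%N -> (graded p)`_j = 0.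
  by rewrite -size_graded; split=> /leq_sizeP.
rewrite /deg_le; case: e => [D|D].
  apply: (iffP idP) => [sp j Dj|p0]; first by apply: (szP D.+1).1; lia.
  suff : (mpoly.msize p <= D.+1)%N by lia.
  by apply/szP => j Dj; apply: p0; lia.
apply: (iffP idP) => [sp j Dj|p0]; first by apply: (szP 0%N).1; lia.
suff : (mpoly.msize p <= 0)%N by lia.
by apply/szP => j Dj; apply: p0; lia.
Qed.

Lemma udeg_leP e (a : {poly F}) : reflect (forall j : nat, e < j%:Z -> a`_j = 0) (udeg_le e a).
Proof.
have szP n : (size a <= n)%N <-> forall j, (n <= j)%N -> a`_j = 0.
  by split=> /leq_sizeP.
rewrite /udeg_le; case: e => [D|D].
  apply: (iffP idP) => [sp j Dj|p0].
    by apply: (szP D.+1).1; move: (size a) sp Dj => n; lia.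
  suff : (size a <= D.+1)%N by move: (size a) => n; lia.
  by apply/szP => j Dj; apply: p0; lia.
apply: (iffP idP) => [sp j Dj|p0].
  by apply: (szP 0%N).1; move: (size a) sp Dj => n; lia.
suff : (size a <= 0)%N by move: (size a) => n; lia.
by apply/szP => j Dj; apply: p0; lia.
Qed.

Lemma deg_le_nat D p : deg_le (Posz D) p = (mpoly.msize p <= D.+1)%N.
Proof. rewrite /deg_le; lia. Qed.

Lemma deg_le_pred_nat D p : deg_le (D%:Z - 1) p = (mpoly.msize p <= D)%N.
Proof. rewrite /deg_le; lia. Qed.

Lemma udeg_le_nat D (a : {poly F}) : udeg_le (Posz D) a = (size a <= D.+1)%N.
Proof. by rewrite /udeg_le; move: (size a) => n; lia. Qed.

Lemma deg_le0 e : deg_le e 0. Proof. by rewrite /deg_le msize0. Qed.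

Lemma deg_le_neg e p : e < 0 -> deg_le e p -> p = 0.
Proof. by rewrite /deg_le => ? ?; apply/eqP; rewrite -msize_poly_eq0; lia. Qed.

Lemma deg_leW e e' p : e <= e' -> deg_le e p -> deg_le e' p.
Proof. rewrite /deg_le; lia. Qed.

Lemma deg_leN e p : deg_le e (- p) = deg_le e p.
Proof. by rewrite /deg_le -!size_graded rmorphN size_polyN. Qed.

Lemma deg_leD e p q : deg_le e p -> deg_le e q -> deg_le e (p + q).
Proof. by have := msizeD_le p q; rewrite /deg_le; lia. Qed.

Lemma deg_leB e p q : deg_le e p -> deg_le e q -> deg_le e (p - q).
Proof. by move=> hp hq; apply: deg_leD; rewrite ?deg_leN. Qed.

Lemma deg_le_large p : exists E : nat, forall e : int, E%:Z <= e -> deg_le e p.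
Proof. by exists (mpoly.msize p) => e; rewrite /deg_le; lia. Qed.

Lemma msize_gt0 p : (0 < mpoly.msize p)%N = (p != 0).
Proof. by rewrite lt0n msize_poly_eq0. Qed.

Lemma msize_mul p q : p != 0 -> q != 0 ->
  mpoly.msize (p * q) = (mpoly.msize p + mpoly.msize q).-1.
Proof. exact: msizeM. Qed.

Lemma deg_leM e e' e'' p q : e + e' <= e'' -> deg_le e p -> deg_le e' q -> deg_le e'' (p * q).
Proof.
have [->|p0] := eqVneq p 0; first by move=> *; rewrite mul0r deg_le0.
have [->|q0] := eqVneq q 0; first by move=> *; rewrite mulr0 deg_le0.
move: p0 q0 (msize_mul p0 q0); rewrite /deg_le -!msize_gt0; lia.
Qed.

(** No zero divisors: degrees add up exactly. *)
Lemma deg_le_cancel e e' p q : (mpoly.msize p)%:Z = e + 1 -> 0 <= e ->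
  deg_le (e + e') (p * q) -> deg_le e' q.
Proof.
have [->|q0] := eqVneq q 0; first by move=> *; rewrite deg_le0.
have [->|p0] := eqVneq p 0; first by rewrite msize0; lia.
move: q0 (msize_mul p0 q0); rewrite /deg_le -msize_gt0; lia.
Qed.

Lemma topD e p q : top e (p + q) = top e p + top e q.
Proof. by case: e => n /=; rewrite ?rmorphD ?coefD ?addr0. Qed.

Lemma topN e p : top e (- p) = - top e p.
Proof. by case: e => n /=; rewrite ?rmorphN ?coefN ?oppr0. Qed.

Lemma topB e p q : top e (p - q) = top e p - top e q.
Proof. by rewrite topD topN. Qed.

Lemma deg_le_pred e p : deg_le e p -> top e p = 0 -> deg_le (e - 1) p.
Proof.
move=> /deg_leP p0 t0; apply/deg_leP => j ej.
have [ej'|ej'] := ltP e j%:Z; first exact: p0.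
by move: t0; rewrite (_ : e = Posz j) //; lia.
Qed.

Lemma top_eq0 e p : deg_le (e - 1) p -> top e p = 0.
Proof. by case: e => [D|n] //= /deg_leP -> //; lia. Qed.

Lemma top_neg e p : e < 0 -> top e p = 0.
Proof. by case: e. Qed.

Lemma top0 e : top e 0 = 0.
Proof. by case: e => n //=; rewrite rmorph0 coef0. Qed.

Lemma topM e e' p q : deg_le e p -> deg_le e' q ->
  top (e + e') (p * q) = top e p * top e' q.
Proof.
have [e0|e0] := ltP e 0.
  by move=> /(deg_le_neg e0) -> _; rewrite mul0r !top0 mul0r.
have [e'0|e'0] := ltP e' 0.
  by move=> _ /(deg_le_neg e'0) ->; rewrite mulr0 !top0 mulr0.
case: e e0 => // D _; case: e' e'0 => // E _.
move=> /deg_leP p0 /deg_leP q0; rewrite /= rmorphM.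
by apply: coefM_top => j Dj; [apply: p0|apply: q0]; lia.
Qed.

Lemma udeg_le_top e p : udeg_le e (top e p).
Proof.
case: e => [D|n] /=; last by rewrite /udeg_le size_poly0.
rewrite udeg_le_nat coef_graded; apply/leq_sizeP => j Dj.
rewrite coef_sum big1 // => m /eqP dm.
rewrite coefZ coefXn; case: eqP => [jm|]; rewrite ?mulr0 //.
by move: dm Dj; rewrite mdeg2 jm; lia.
Qed.

Lemma udeg_le_neg e a : e < 0 -> udeg_le e a -> a = 0.
Proof.
rewrite /udeg_le => e0 sa; apply/eqP; rewrite -size_poly_eq0.
by move: (size a) sa => n; lia.
Qed.

Lemma udeg_leB e a a' : udeg_le e a -> udeg_le e a' -> udeg_le e (a - a').
Proof.
move=> /udeg_leP sa /udeg_leP sa'; apply/udeg_leP => j ej.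
by rewrite coefB sa // sa' // subrr.
Qed.

Lemma udeg_leM e e' e'' a a' : e + e' <= e'' ->
  udeg_le e a -> udeg_le e' a' -> udeg_le e'' (a * a').
Proof.
move=> ee; have [->|a0] := eqVneq a 0; first by rewrite mul0r /udeg_le size_poly0.
have [->|a0'] := eqVneq a' 0; first by rewrite mulr0 /udeg_le size_poly0.
rewrite /udeg_le size_mul //; move: a0 a0'; rewrite -!size_poly_eq0.
by move: (size a) (size a') => m n; lia.
Qed.

Lemma top_surj e a : udeg_le e a -> exists2 p, deg_le e p & top e p = a.
Proof.
have [e0 /(udeg_le_neg e0) ->|] := ltP e 0; first by exists 0; rewrite ?deg_le0 ?top0.
case: e => // D _; rewrite udeg_le_nat => sa.
pose mon i : multinom 2 := Multinom [tuple i; (D - i)%N].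
pose p : P := \sum_(i < D.+1) a`_i *: mpolyX F (mon i).
have tp : graded p = a%:P * 'X^D.
  rewrite rmorph_sum /= -[in RHS](coefK a) poly_def.
  rewrite (big_ord_widen _ (fun i => a`_i *: 'X^i) sa) rmorph_sum mulr_suml.
  rewrite [RHS]big_mkcond /=; apply: eq_bigr => i _.
  rewrite gradedZ gradedX mdeg2 !multinomE /= !(tnth_nth 0%N) /= subnKC; last first.
    by rewrite -ltnS.
  case: ltnP => [_|/(nth_default 0) ->]; last by rewrite !polyC0 mul0r.
  by rewrite mulrA -polyCM [(a`_i)%:P * _]mul_polyC.
exists p; last by rewrite /= tp coefMXn ltnn subnn coefC.
apply/deg_leP => j Dj; rewrite tp coefMXn.
case: ltnP => [|_]; first by []; rewrite coefC.
by case: eqP => // jD; lia.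
Qed.

Lemma deg_le_mderiv i e p : deg_le e p -> deg_le (e - 1) (mderiv i p).
Proof.
rewrite /deg_le => sp.
suff : (mpoly.msize (mderiv i p) <= (mpoly.msize p).-1)%N by lia.
rewrite [X in (X <= _)%N]msizeE; apply/bigmax_leqP_seq => m + _.
rewrite mcoeff_msupp mcoeff_mderiv => mp.
have : mnm_add m (mnm1 i) \in msupp p.
  by rewrite mcoeff_msupp; apply: contraNneq mp => ->; rewrite mul0rn.
by move=> /msize_mdeg_lt; rewrite mdegD mdeg1; lia.
Qed.

Lemma deg_le_mderivS i (D : nat) p : deg_le (Posz D.+1) p -> deg_le (Posz D) (mderiv i p).
Proof. by move=> /(deg_le_mderiv i); apply: deg_leW; lia. Qed.

End TotalDegree.

(** * Lowering degrees by means of leading forms *)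

Section DegreeReduction.
Variable F : closedFieldType.
Local Notation P := (mpoly 2 F).

Definition full (D : int) (a : {poly F}) :=
  (size a != 0)%N && ((size a)%:Z == D + 1).

(** Forms of degree [D1], [D2], [D3] in two variables, dehomogenized, without
    common zero on the projective line: the second part concerns the point at
    which the dehomogenizing variable vanishes. *)
Definition no_common_zero D1 (a1 : {poly F}) D2 (a2 : {poly F}) D3 (a3 : {poly F}) :=
  (forall x, ~~ [&& a1.[x] == 0, a2.[x] == 0 & a3.[x] == 0]) /\
  [|| full D1 a1, full D2 a2 | full D3 a3].

Lemma udeg_le_cancel D e (a b : {poly F}) :
  full D a -> udeg_le (e + D) (b * a) -> udeg_le e b.
Proof.
rewrite /full /udeg_le => /andP[a0 /eqP sa].
have [->|b0] := eqVneq b 0; first by rewrite size_poly0.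
have a0' : a != 0 by rewrite -size_poly_eq0.
rewrite size_mul //.
have : (size b != 0)%N by rewrite size_poly_eq0.
move: (size a) (size b) a0 sa => m n; lia.
Qed.

(** With a Bezout relation [t . a = 1], the factor is [t . b].  Its degree is read
    on a component of [a] that does not vanish at the remaining point of the
    line. *)
Lemma proportional e D0 D1 D2 (a0 a1 a2 b0 b1 b2 : {poly F}) :
    no_common_zero D0 a0 D1 a1 D2 a2 ->
    b1 * a2 = b2 * a1 -> b2 * a0 = b0 * a2 -> b0 * a1 = b1 * a0 ->
    udeg_le (e + D0) b0 -> udeg_le (e + D1) b1 -> udeg_le (e + D2) b2 ->
  exists c, [/\ udeg_le e c, b0 = c * a0, b1 = c * a1 & b2 = c * a2].
Proof.
move=> [nz inf] e12 e20 e01 s0 s1 s2.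
have [t0 [t1 [t2 t]]] := bezout3 nz.
pose c := t0 * b0 + t1 * b1 + t2 * b2.
have c0 : b0 = c * a0.
  rewrite /c -[LHS]mul1r -t.
  have -> : (t0 * b0 + t1 * b1 + t2 * b2) * a0 =
    t0 * b0 * a0 + t1 * (b1 * a0) + t2 * (b2 * a0) by ring.
  rewrite -e01 e20; ring.
have c1 : b1 = c * a1.
  rewrite /c -[LHS]mul1r -t.
  have -> : (t0 * b0 + t1 * b1 + t2 * b2) * a1 =
    t0 * (b0 * a1) + t1 * b1 * a1 + t2 * (b2 * a1) by ring.
  rewrite e01 -e12; ring.
have c2 : b2 = c * a2.
  rewrite /c -[LHS]mul1r -t.
  have -> : (t0 * b0 + t1 * b1 + t2 * b2) * a2 =
    t0 * (b0 * a2) + t1 * (b1 * a2) + t2 * b2 * a2 by ring.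
  rewrite -e20 e12; ring.
exists c; split=> //.
case/or3P: inf => h; apply: udeg_le_cancel h _.
- by rewrite -c0.
- by rewrite -c1.
- by rewrite -c2.
Qed.

Lemma topME e e' e'' (p q : P) : e'' = e + e' -> deg_le e p -> deg_le e' q ->
  top e'' (p * q) = top e p * top e' q.
Proof. by move=> ->; apply: topM. Qed.

(** When the leading forms of [u] have no common zero, the degree of [w] can be
    made to match that of its cross product with [u] by subtracting a multiple
    of [u]: the leading form of a [w] of excessive degree is parallel to that
    of [u]. *)
Lemma reduce_cross (b d0 d1 d2 : int) (u0 u1 u2 w0 w1 w2 : P) :
    deg_le d0 u0 -> deg_le d1 u1 -> deg_le d2 u2 ->
    no_common_zero d0 (top d0 u0) d1 (top d1 u1) d2 (top d2 u2) ->
    deg_le (b + d1 + d2) (w1 * u2 - w2 * u1) ->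
    deg_le (b + d2 + d0) (w2 * u0 - w0 * u2) ->
    deg_le (b + d0 + d1) (w0 * u1 - w1 * u0) ->
  exists A, [/\ deg_le (b + d0) (w0 - A * u0), deg_le (b + d1) (w1 - A * u1)
              & deg_le (b + d2) (w2 - A * u2)].
Proof.
move=> du0 du1 du2 nz.
have [E0 hE0] := deg_le_large w0; have [E1 hE1] := deg_le_large w1.
have [E2 hE2] := deg_le_large w2.
have [E [E0le E1le E2le]] : exists E : nat, [/\ E0%:Z <= b + d0 + E%:Z,
    E1%:Z <= b + d1 + E%:Z & E2%:Z <= b + d2 + E%:Z].
  exists (E0 + E1 + E2 + `|b| + `|d0| + `|d1| + `|d2|)%N; split; clear; lia.
move: (hE0 _ E0le) (hE1 _ E1le) (hE2 _ E2le) => {hE0 hE1 hE2 E0le E1le E2le E0 E1 E2}.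
elim: E w0 w1 w2 => [|E IH] w0 w1 w2 dw0 dw1 dw2 c0 c1 c2.
  by exists 0; rewrite !mul0r !subr0; split; [move: dw0|move: dw1|move: dw2];
     rewrite addr0.
have [e eE] : exists e : int, e = b + E.+1%:Z by exists (b + E.+1%:Z).
have {}dw0 : deg_le (e + d0) w0 by apply: deg_leW dw0; move: eE; clear; lia.
have {}dw1 : deg_le (e + d1) w1 by apply: deg_leW dw1; move: eE; clear; lia.
have {}dw2 : deg_le (e + d2) w2 by apply: deg_leW dw2; move: eE; clear; lia.
have top_cross (i j : int) (p q p' q' : P) : deg_le (e + i) p -> deg_le j q ->
    deg_le (e + j) p' -> deg_le i q' -> deg_le (b + i + j) (p * q - p' * q') ->
    top (e + i) p * top j q = top (e + j) p' * top i q'.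
  move=> dp dq dp' dq' dpq.
  have t1 : top (e + i + j) (p * q) = top (e + i) p * top j q by apply: topME.
  have t2 : top (e + i + j) (p' * q') = top (e + j) p' * top i q'.
    by apply: topME; [clear; lia| |].
  have : top (e + i + j) (p * q - p' * q') = 0.
    by apply: top_eq0; apply: deg_leW dpq; move: eE; clear; lia.
  by rewrite topB t1 t2 => /subr0_eq.
have [a [sa a0 a1 a2]] := proportional nz (top_cross _ _ _ _ _ _ dw1 du2 dw2 du1 c0)
  (top_cross _ _ _ _ _ _ dw2 du0 dw0 du2 c1) (top_cross _ _ _ _ _ _ dw0 du1 dw1 du0 c2)
  (udeg_le_top _ _) (udeg_le_top _ _) (udeg_le_top _ _).
have [A dA tA] := top_surj sa.
have lower (i : int) (w u : P) : deg_le (e + i) w -> deg_le i u ->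
    top (e + i) w = a * top i u -> deg_le (b + i + E%:Z) (w - A * u).
  move=> dw du wu; have -> : b + i + E%:Z = e + i - 1 by move: eE; clear; lia.
  apply: deg_le_pred; first by apply: deg_leB => //; apply: deg_leM dA du.
  by rewrite topB (topM dA du) tA wu subrr.
have [A' [l0 l1 l2]] := IH _ _ _ (lower _ _ _ dw0 du0 a0) (lower _ _ _ dw1 du1 a1)
  (lower _ _ _ dw2 du2 a2) ltac:(by have -> : (w1 - A * u1) * u2 - (w2 - A * u2) * u1 =
    w1 * u2 - w2 * u1 by ring) ltac:(by have -> : (w2 - A * u2) * u0 - (w0 - A * u0) * u2 =
    w2 * u0 - w0 * u2 by ring) ltac:(by have -> : (w0 - A * u0) * u1 - (w1 - A * u1) * u0 =
    w0 * u1 - w1 * u0 by ring).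
by exists (A + A'); rewrite !mulrDl !opprD !addrA.
Qed.

(** The case [u = (f, - g, 0)] and [w = (s, t, 0)] of the preceding lemma. *)
Lemma reduce_pair (b df dg : int) (f g s t : P) :
    deg_le df f -> deg_le dg g ->
    no_common_zero df (top df f) dg (top dg g) 0 0 ->
    deg_le (b + df + dg) (s * g + t * f) ->
  exists A, deg_le (b + df) (s - A * f) /\ deg_le (b + dg) (t + A * g).
Proof.
move=> df_ dg_ [nz inf] dst.
have dg' : deg_le dg (- g) by rewrite deg_leN.
have nz' : no_common_zero df (top df f) dg (top dg (- g)) 0 (top 0 (0 : P)).
  split=> [x|]; first by rewrite topN top0 hornerN oppr_eq0 nz.
  by rewrite topN top0 /full size_polyN.
have c0 : deg_le (b + dg + 0) (t * 0 - 0 * - g) by rewrite mulr0 mul0r subrr deg_le0.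
have c1 : deg_le (b + 0 + df) (0 * f - s * 0) by rewrite mulr0 mul0r subrr deg_le0.
have c2 : deg_le (b + df + dg) (s * - g - t * f).
  have -> : s * - g - t * f = - (s * g + t * f) by ring.
  by rewrite deg_leN.
have [A [h1 h2 _]] := reduce_cross df_ dg' (deg_le0 _ _) nz' c0 c1 c2.
by exists A; split=> //; move: h2; rewrite mulrN opprK.
Qed.

(** A vector whose determinant with two vectors of forms vanishes is a
    combination of these, if their minors have no common zero: its cross
    products with the second one are parallel to the minors, so that it becomes
    parallel to the second one after subtraction of a multiple of the first. *)
Lemma combination_of_rows e k d0 d1 d2 (u0 u1 u2 v0 v1 v2 w0 w1 w2 : {poly F}) :
    udeg_le d0 u0 -> udeg_le d1 u1 -> udeg_le d2 u2 ->
    udeg_le (d0 + k) v0 -> udeg_le (d1 + k) v1 -> udeg_le (d2 + k) v2 ->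
    udeg_le (e + d0) w0 -> udeg_le (e + d1) w1 -> udeg_le (e + d2) w2 ->
    no_common_zero (d0 + k) v0 (d1 + k) v1 (d2 + k) v2 ->
    no_common_zero (d1 + d2 + k) (u1 * v2 - u2 * v1)
      (d2 + d0 + k) (u2 * v0 - u0 * v2) (d0 + d1 + k) (u0 * v1 - u1 * v0) ->
    w0 * (u1 * v2 - u2 * v1) + w1 * (u2 * v0 - u0 * v2)
      + w2 * (u0 * v1 - u1 * v0) = 0 ->
  exists a c, [/\ udeg_le e a, udeg_le (e - k) c, w0 - a * u0 = c * v0,
    w1 - a * u1 = c * v1 & w2 - a * u2 = c * v2].
Proof.
move=> su0 su1 su2 sv0 sv1 sv2 sw0 sw1 sw2 nzv nzm det0.
have sC (i j : int) (p q p' q' : {poly F}) : udeg_le (e + i) p -> udeg_le (j + k) q ->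
    udeg_le (e + j) p' -> udeg_le (i + k) q' -> udeg_le (e + (i + j + k)) (p * q - p' * q').
  move=> sp sq sp' sq'; apply: udeg_leB.
    by apply: udeg_leM sp sq; clear; lia.
  by apply: udeg_leM sp' sq'; clear; lia.
have [a [sa a0 a1 a2]] : exists a, [/\ udeg_le e a,
    w1 * v2 - w2 * v1 = a * (u1 * v2 - u2 * v1),
    w2 * v0 - w0 * v2 = a * (u2 * v0 - u0 * v2) &
    w0 * v1 - w1 * v0 = a * (u0 * v1 - u1 * v0)].
  apply: (proportional nzm (e := e)).
  - by apply: subr0_eq; rewrite -[RHS](mulr0 v0) -det0; ring.
  - by apply: subr0_eq; rewrite -[RHS](mulr0 v1) -det0; ring.
  - by apply: subr0_eq; rewrite -[RHS](mulr0 v2) -det0; ring.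
  - exact: sC sw1 sv2 sw2 sv1.
  - exact: sC sw2 sv0 sw0 sv2.
  - exact: sC sw0 sv1 sw1 sv0.
have sW (i : int) (w u : {poly F}) : udeg_le (e + i) w -> udeg_le i u ->
    udeg_le (e - k + (i + k)) (w - a * u).
  move=> sw su; have -> : e - k + (i + k) = e + i by clear; lia.
  by apply: udeg_leB => //; apply: udeg_leM sa su.
have [c [sc c0 c1 c2]] := proportional nzv
  (b0 := w0 - a * u0) (b1 := w1 - a * u1) (b2 := w2 - a * u2)
  ltac:(apply: subr0_eq; rewrite -[RHS](subrr (a * (u1 * v2 - u2 * v1))) -{1}a0; ring)
  ltac:(apply: subr0_eq; rewrite -[RHS](subrr (a * (u2 * v0 - u0 * v2))) -{1}a1; ring)
  ltac:(apply: subr0_eq; rewrite -[RHS](subrr (a * (u0 * v1 - u1 * v0))) -{1}a2; ring)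
  (sW _ _ _ sw0 su0) (sW _ _ _ sw1 su1) (sW _ _ _ sw2 su2).
by exists a, c.
Qed.

(** The leading form of a [w] of excessive degree has determinant zero with
    those of [u] and [v], hence is a combination of them. *)
Lemma reduce_det (b k d0 d1 d2 : int) (u0 u1 u2 v0 v1 v2 w0 w1 w2 : P) :
    deg_le d0 u0 -> deg_le d1 u1 -> deg_le d2 u2 ->
    deg_le (d0 + k) v0 -> deg_le (d1 + k) v1 -> deg_le (d2 + k) v2 ->
    no_common_zero (d0 + k) (top (d0 + k) v0) (d1 + k) (top (d1 + k) v1)
      (d2 + k) (top (d2 + k) v2) ->
    no_common_zero (d1 + d2 + k) (top (d1 + d2 + k) (u1 * v2 - u2 * v1))
      (d2 + d0 + k) (top (d2 + d0 + k) (u2 * v0 - u0 * v2))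
      (d0 + d1 + k) (top (d0 + d1 + k) (u0 * v1 - u1 * v0)) ->
    deg_le (b + d0 + d1 + d2 + k)
      (w0 * (u1 * v2 - u2 * v1) + w1 * (u2 * v0 - u0 * v2) + w2 * (u0 * v1 - u1 * v0)) ->
  exists A B, [/\ deg_le (b + d0) (w0 - A * u0 - B * v0),
    deg_le (b + d1) (w1 - A * u1 - B * v1) & deg_le (b + d2) (w2 - A * u2 - B * v2)].
Proof.
move=> du0 du1 du2 dv0 dv1 dv2 nzv nzm.
have [E0 hE0] := deg_le_large w0; have [E1 hE1] := deg_le_large w1.
have [E2 hE2] := deg_le_large w2.
have [E [E0le E1le E2le]] : exists E : nat, [/\ E0%:Z <= b + d0 + E%:Z,
    E1%:Z <= b + d1 + E%:Z & E2%:Z <= b + d2 + E%:Z].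
  exists (E0 + E1 + E2 + `|b| + `|d0| + `|d1| + `|d2|)%N; split; clear; lia.
move: (hE0 _ E0le) (hE1 _ E1le) (hE2 _ E2le) => {hE0 hE1 hE2 E0le E1le E2le E0 E1 E2}.
elim: E w0 w1 w2 => [|E IH] w0 w1 w2 dw0 dw1 dw2 dd.
  by exists 0, 0; rewrite !mul0r !subr0; split; [move: dw0|move: dw1|move: dw2];
     rewrite addr0.
have [e eE] : exists e : int, e = b + E.+1%:Z by exists (b + E.+1%:Z).
have {}dw0 : deg_le (e + d0) w0 by apply: deg_leW dw0; move: eE; clear; lia.
have {}dw1 : deg_le (e + d1) w1 by apply: deg_leW dw1; move: eE; clear; lia.
have {}dw2 : deg_le (e + d2) w2 by apply: deg_leW dw2; move: eE; clear; lia.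
have topu (i j : int) (p q p' q' : P) : deg_le i p -> deg_le (j + k) q -> deg_le j p' ->
    deg_le (i + k) q' -> top (i + j + k) (p * q - p' * q') =
    top i p * top (j + k) q - top j p' * top (i + k) q'.
  move=> dp dq dp' dq'.
  have t1 : top (i + j + k) (p * q) = top i p * top (j + k) q.
    by apply: topME; [clear; lia| |].
  have t2 : top (i + j + k) (p' * q') = top j p' * top (i + k) q'.
    by apply: topME; [clear; lia| |].
  by rewrite topB t1 t2.
have deg_leC (i j : int) (p q p' q' : P) : deg_le i p -> deg_le (j + k) q -> deg_le j p' ->
    deg_le (i + k) q' -> deg_le (i + j + k) (p * q - p' * q').
  move=> dp dq dp' dq'; apply: deg_leB.
    by apply: deg_leM dp dq; clear; lia.
  by apply: deg_leM dp' dq'; clear; lia.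
have dm0 := deg_leC _ _ _ _ _ _ du1 dv2 du2 dv1.
have dm1 := deg_leC _ _ _ _ _ _ du2 dv0 du0 dv2.
have dm2 := deg_leC _ _ _ _ _ _ du0 dv1 du1 dv0.
have det0 : top (e + d0 + d1 + d2 + k) (w0 * (u1 * v2 - u2 * v1)
    + w1 * (u2 * v0 - u0 * v2) + w2 * (u0 * v1 - u1 * v0)) = 0.
  by apply: top_eq0; apply: deg_leW dd; move: eE; clear; lia.
have t0 : top (e + d0 + d1 + d2 + k) (w0 * (u1 * v2 - u2 * v1)) =
    top (e + d0) w0 * top (d1 + d2 + k) (u1 * v2 - u2 * v1).
  by apply: topME; [clear; lia| |].
have t1 : top (e + d0 + d1 + d2 + k) (w1 * (u2 * v0 - u0 * v2)) =
    top (e + d1) w1 * top (d2 + d0 + k) (u2 * v0 - u0 * v2).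
  by apply: topME; [clear; lia| |].
have t2 : top (e + d0 + d1 + d2 + k) (w2 * (u0 * v1 - u1 * v0)) =
    top (e + d2) w2 * top (d0 + d1 + k) (u0 * v1 - u1 * v0).
  by apply: topME; [clear; lia| |].
have [a [c [sa sc a0 a1 a2]]] : exists a c, [/\ udeg_le e a, udeg_le (e - k) c,
    top (e + d0) w0 - a * top d0 u0 = c * top (d0 + k) v0,
    top (e + d1) w1 - a * top d1 u1 = c * top (d1 + k) v1 &
    top (e + d2) w2 - a * top d2 u2 = c * top (d2 + k) v2].
  have ut := @udeg_le_top F.
  apply: (combination_of_rows (ut _ _) (ut _ _) (ut _ _) (ut _ _) (ut _ _) (ut _ _)
    (ut _ _) (ut _ _) (ut _ _) nzv).
    move: nzm; rewrite (topu _ _ _ _ _ _ du1 dv2 du2 dv1).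
    by rewrite (topu _ _ _ _ _ _ du2 dv0 du0 dv2) (topu _ _ _ _ _ _ du0 dv1 du1 dv0).
  move: det0; rewrite !topD t0 t1 t2 (topu _ _ _ _ _ _ du1 dv2 du2 dv1).
  by rewrite (topu _ _ _ _ _ _ du2 dv0 du0 dv2) (topu _ _ _ _ _ _ du0 dv1 du1 dv0).
have [A dA tA] := top_surj sa.
have [B dB tB] := top_surj sc.
have lower (i : int) (w u v : P) : deg_le (e + i) w -> deg_le i u -> deg_le (i + k) v ->
    top (e + i) w - a * top i u = c * top (i + k) v ->
    deg_le (b + i + E%:Z) (w - A * u - B * v).
  move=> dw du dv wuv.
  have -> : b + i + E%:Z = e + i - 1 by move: eE; clear; lia.
  have dBv : deg_le (e + i) (B * v) by apply: deg_leM dB dv; clear; lia.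
  have tBv : top (e + i) (B * v) = c * top (i + k) v.
    by rewrite -tB; apply: topME; [clear; lia| |].
  apply: deg_le_pred.
    by apply: deg_leB => //; apply: deg_leB => //; apply: deg_leM dA du.
  by rewrite !topB (topM dA du) tA wuv tBv subrr.
have [|A' [B' [l0 l1 l2]]] := IH _ _ _ (lower _ _ _ _ dw0 du0 dv0 a0)
  (lower _ _ _ _ dw1 du1 dv1 a1) (lower _ _ _ _ dw2 du2 dv2 a2).
  by move: dd; congr (deg_le _ _); ring.
exists (A + A'), (B + B').
have reassoc (w u v : P) : w - (A + A') * u - (B + B') * v =
  w - A * u - B * v - A' * u - B' * v by ring.
by split; rewrite reassoc.
Qed.

End DegreeReduction.

(** * The weak Nullstellensatz in two variables *)

Section MpolyNullstellensatz.
Variable F : closedFieldType.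
Local Notation P := (mpoly 2 F).
Local Notation x := (mpolyX F (mnm1 0) : P).
Local Notation y := (mpolyX F (mnm1 1) : P).

Lemma mpolyX2 (m : multinom 2) : mpolyX F m = x ^+ m 0 * y ^+ m 1.
Proof.
rewrite mpolyXE_id big_ord_recl big_ord1.
by have -> : lift ord0 ord0 = 1 :> 'I_2 by apply: val_inj.
Qed.

Lemma mpoly2_rmorph_eq (S : comNzRingType) (h1 h2 : {rmorphism P -> S}) :
    (forall c, h1 (mpolyC 2 c) = h2 (mpolyC 2 c)) -> h1 x = h2 x -> h1 y = h2 y ->
  h1 =1 h2.
Proof.
move=> hC hx hy p; rewrite (mpolyE p) !rmorph_sum; apply: eq_bigr => m _.
by rewrite -mul_mpolyC mpolyX2 !rmorphM !rmorphXn hC hx hy.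
Qed.

(** The change of variables [x -> x + c y] makes a given nonzero polynomial
    monic in [y], up to a constant, for all but finitely many [c]. *)
Definition shear_form (c : F) : {poly {poly F}} := 'X%:P + c%:P%:P * 'X.

Definition shear_var (c : F) (i : 'I_2) : {poly {poly F}} :=
  if i == 0 then shear_form c else 'X.

Definition shear (c : F) : P -> {poly {poly F}} :=
  mmap ((@polyC {poly F}) \o (@polyC F)) (shear_var c).

HB.instance Definition _ c := GRing.RMorphism.on (shear c).

Definition unshear (c : F) : {poly {poly F}} -> P :=
  horner_eval y \o map_poly (horner_alg (x - c *: y)).

HB.instance Definition _ c := GRing.RMorphism.on (unshear c).

Lemma shearC c a : shear c (mpolyC 2 a) = a%:P%:P.
Proof. by rewrite /shear mmapC. Qed.

Lemma shearx c : shear c x = shear_form c.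
Proof. by rewrite /shear mmapX mmap1U. Qed.

Lemma sheary c : shear c y = 'X.
Proof. by rewrite /shear mmapX mmap1U. Qed.

Lemma shearK c : cancel (shear c) (unshear c).
Proof.
apply: (@mpoly2_rmorph_eq P (unshear c \o shear c) idfun) => [a||] /=.
- by rewrite shearC /unshear /= map_polyC /= horner_evalE hornerC horner_algC alg_mpolyC.
- rewrite shearx /shear_form /unshear /= rmorphD rmorphM /= !map_polyC map_polyX /=.
  rewrite horner_algX horner_algC horner_evalE !hornerE alg_mpolyC mul_mpolyC.
  by rewrite subrK.
- by rewrite sheary /unshear /= map_polyX horner_evalE hornerX.
Qed.

Lemma shear_horner c p (v : 'I_2 -> F) :
  (shear c p).[(v 1)%:P].[v 0 - c * v 1] = meval v p.
Proof.
pose h := horner_eval (v 0 - c * v 1) \o horner_eval (v 1)%:P \o shear c.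
apply: (@mpoly2_rmorph_eq F h (meval v)) => [a||] /=; rewrite /h /= !horner_evalE.
- by rewrite shearC !hornerC mevalC.
- by rewrite shearx /shear_form !hornerE mevalXU subrK.
- by rewrite sheary !hornerE mevalXU.
Qed.

Lemma size_coef_shear_var (c : F) i :
  (size (shear_form c ^+ i)%R <= i.+1)%N /\
  (shear_form c ^+ i)`_i = (c ^+ i)%:P.
Proof.
elim: i => [|i [szi ci]]; first by rewrite !expr0 size_poly1 coef1 polyC1.
have sz2 : (size (shear_form c) <= 2)%N.
  rewrite /shear_form addrC size_MXaddC; by case: ifP => // _; rewrite ltnS size_polyC_leq1.
split; first by rewrite exprS; apply: leq_trans (size_polyMleq _ _) _; lia.
rewrite exprS {1}/shear_form mulrDl coefD coefCM nth_default ?mulr0 ?add0r //.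
by rewrite -mulrA coefCM coefXM /= ci exprS polyCM.
Qed.

Lemma lead_shear c m p : deg_le (Posz m) p ->
  (size (shear c p) <= m.+1)%N /\ (shear c p)`_m = (top m p).[c]%:P.
Proof.
move=> dp.
have msupp_le k : k \in msupp p -> (mdeg k <= m)%N.
  by move/msize_mdeg_lt; move: dp; rewrite /deg_le; lia.
have shearE : shear c p = \sum_(k <- msupp p)
    (mcoeff k p)%:P%:P * (shear_form c ^+ k 0 * 'X ^+ k 1).
  rewrite {1}(mpolyE p) rmorph_sum; apply: eq_bigr => k _.
  by rewrite -mul_mpolyC mpolyX2 !rmorphM !rmorphXn /= shearC shearx sheary.
split.
  rewrite shearE; apply: leq_trans (size_sum _ _ _) _.
  apply/bigmax_leqP_seq => k kp _; rewrite mul_polyC.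
  apply: leq_trans (size_scale_leq _ _) _.
  apply: leq_trans (size_polyMleq _ _) _; rewrite size_polyXn.
  have [sz _] := size_coef_shear_var c (k 0).
  by have := msupp_le _ kp; rewrite mdeg2; lia.
rewrite shearE coef_sum /= coef_graded horner_sum rmorph_sum /= [RHS]big_mkcond /=.
rewrite big_seq [RHS]big_seq; apply: eq_bigr => k kp.
rewrite coefCM coefMXn hornerZ hornerXn.
have [sz ck] := size_coef_shear_var c (k 0).
have := msupp_le _ kp; rewrite mdeg2 leq_eqVlt; case: eqVneq => [<- _|ne /= lt].
  by rewrite ltnNge leq_addl /= addnK ck polyCM.
case: ltnP => [|le]; first by rewrite mulr0.
rewrite nth_default ?mulr0 //; apply: leq_trans sz _.
by rewrite ltn_subRL addnC.
Qed.

Lemma top_neq0 (m : nat) (p : P) : mpoly.msize p = m.+1 -> top m p != 0.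
Proof.
move=> sp; apply/eqP => t0.
have : deg_le (m%:Z - 1) p by apply: deg_le_pred => //; rewrite /deg_le sp; lia.
by rewrite /deg_le sp; lia.
Qed.

(** After a shear, the restriction to [x = 0] has the same degree as [p]. *)
Lemma mpoly_nonroot (p : P) : p != 0 -> exists v, meval v p != 0.
Proof.
rewrite -msize_poly_eq0 => p0.
have [m sp] : exists m, mpoly.msize p = m.+1.
  by exists (mpoly.msize p).-1; rewrite prednK // lt0n.
have /closed_nonrootP[c] := top_neq0 sp; rewrite /root => kc.
have [|_ lead] := @lead_shear c m p; first by rewrite /deg_le sp; lia.
have /closed_nonrootP[y0] : map_poly (horner_eval 0) (shear c p) != 0.
  apply: contraNneq kc => /polyP/(_ m).
  by rewrite coef_map /= lead horner_evalE hornerC coef0 => ->.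
rewrite /root => ry; exists (fun i => if i == 0 then c * y0 else y0).
rewrite -(shear_horner c) /= subrr; apply: contraNneq ry => ry.
have -> : (map_poly (horner_eval 0) (shear c p)).[y0] = (shear c p).[y0%:P].[0].
  by rewrite -[RHS]horner_evalE -horner_map /= horner_evalE hornerC.
by rewrite ry.
Qed.

Lemma nullstellensatz3 (p q r : P) : p != 0 ->
    (forall v, ~~ [&& meval v p == 0, meval v q == 0 & meval v r == 0]) ->
  exists a b c, a * p + b * q + c * r = 1.
Proof.
rewrite -msize_poly_eq0 => p0 nz.
have [m sp] : exists m, mpoly.msize p = m.+1.
  by exists (mpoly.msize p).-1; rewrite prednK // lt0n.
have /closed_nonrootP[c] := top_neq0 sp; rewrite /root => kc.
set k := (top m p).[c] in kc.
have [|sz lead] := @lead_shear c m p; first by rewrite /deg_le sp; lia.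
pose p' := k^-1%:P%:P * shear c p.
have p'm : p' \is monic.
  have szp : size (shear c p) = m.+1.
    apply/eqP; rewrite eqn_leq sz ltnNge; apply/negP => /leq_sizeP/(_ m (leqnn _)).
    by move/eqP; rewrite lead polyC_eq0; apply/negP.
  rewrite /p' monicE lead_coefM lead_coefC lead_coefE szp /= lead -polyCM.
  by rewrite mulVf.
have [X Y|a [b [e abe]]] := @nullstellensatz_monic F p' (shear c q) (shear c r) p'm.
  pose v (i : 'I_2) := if i == 0 then X + c * Y else Y.
  have := nz v; rewrite -!(shear_horner c) /v /= addrK /p'.
  by rewrite !hornerM !hornerC mulf_eq0 invr_eq0 (negPf kc).
exists (unshear c (a * k^-1%:P%:P)), (unshear c b), (unshear c e).
have := congr1 (unshear c) abe; rewrite rmorph1 => <-.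
by rewrite /p' !rmorphD !rmorphM /= !shearK !mulrA.
Qed.
End MpolyNullstellensatz.

(** * Division of the cofactor difference by the minors *)

Section Division.
Variable F : closedFieldType.
Local Notation P := (mpoly 2 F).

(** Exactness of the Koszul complex of [u], in bounded degree: if [e . u = 1]
    and [c . u = 0], then [c = (e x c) x u], and the degree of the first factor
    can be lowered. *)
Lemma koszul (b d0 d1 d2 : int) (u0 u1 u2 c0 c1 c2 e0 e1 e2 : P) :
    deg_le d0 u0 -> deg_le d1 u1 -> deg_le d2 u2 ->
    e0 * u0 + e1 * u1 + e2 * u2 = 1 ->
    no_common_zero d0 (top d0 u0) d1 (top d1 u1) d2 (top d2 u2) ->
    c0 * u0 + c1 * u1 + c2 * u2 = 0 ->
    deg_le (b + d1 + d2) c0 -> deg_le (b + d2 + d0) c1 -> deg_le (b + d0 + d1) c2 ->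
  exists w0 w1 w2,
    [/\ deg_le (b + d0) w0, deg_le (b + d1) w1 & deg_le (b + d2) w2] /\
    [/\ c0 = w1 * u2 - w2 * u1, c1 = w2 * u0 - w0 * u2 & c2 = w0 * u1 - w1 * u0].
Proof.
move=> du0 du1 du2 eu nz cu dc0 dc1 dc2.
pose w0 := e1 * c2 - e2 * c1; pose w1 := e2 * c0 - e0 * c2.
pose w2 := e0 * c1 - e1 * c0.
have c0E : c0 = w1 * u2 - w2 * u1.
  have -> : w1 * u2 - w2 * u1 = c0 * (e0 * u0 + e1 * u1 + e2 * u2)
    - e0 * (c0 * u0 + c1 * u1 + c2 * u2) by rewrite /w1 /w2; ring.
  by rewrite eu cu mulr1 mulr0 subr0.
have c1E : c1 = w2 * u0 - w0 * u2.
  have -> : w2 * u0 - w0 * u2 = c1 * (e0 * u0 + e1 * u1 + e2 * u2)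
    - e1 * (c0 * u0 + c1 * u1 + c2 * u2) by rewrite /w0 /w2; ring.
  by rewrite eu cu mulr1 mulr0 subr0.
have c2E : c2 = w0 * u1 - w1 * u0.
  have -> : w0 * u1 - w1 * u0 = c2 * (e0 * u0 + e1 * u1 + e2 * u2)
    - e2 * (c0 * u0 + c1 * u1 + c2 * u2) by rewrite /w0 /w1; ring.
  by rewrite eu cu mulr1 mulr0 subr0.
rewrite c0E in dc0; rewrite c1E in dc1; rewrite c2E in dc2.
have [A [l0 l1 l2]] := reduce_cross du0 du1 du2 nz dc0 dc1 dc2.
exists (w0 - A * u0), (w1 - A * u1), (w2 - A * u2).
split=> //; split.
- rewrite [LHS]c0E; ring.
- rewrite [LHS]c1E; ring.
- rewrite [LHS]c2E; ring.
Qed.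

(** Here [u = (f, f_x, f_y)] and [v = (g, g_x, g_y)], of degrees
    [(m, m - 1, m - 1)] and [(n, n - 1, n - 1)], while [a], [b] are the
    components of the vector field.  The equation [L u0 = det (w, u, v)] is
    divided by [u0], as explained at the top. *)
Lemma cofactor_in_minors (m n d : int) (u0 u1 u2 v0 v1 v2 e0 e1 e2 t0 t1 t2
    K a b L : P) :
    0 <= m -> (mpoly.msize u0)%:Z = m + 1 -> deg_le (m - 1) u1 -> deg_le (m - 1) u2 ->
    deg_le n v0 -> deg_le (n - 1) v1 -> deg_le (n - 1) v2 ->
    e0 * u0 + e1 * u1 + e2 * u2 = 1 ->
    t0 * u0 + t1 * v0 + t2 * (u1 * v2 - u2 * v1) = 1 ->
    no_common_zero m (top m u0) (m - 1) (top (m - 1) u1) (m - 1) (top (m - 1) u2) ->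
    no_common_zero m (top m u0) n (top n v0) 0 0 ->
    (m < n ->
      no_common_zero n (top n v0) (n - 1) (top (n - 1) v1) (n - 1) (top (n - 1) v2) /\
      no_common_zero (m + n - 2) (top (m + n - 2) (u1 * v2 - u2 * v1))
        (m + n - 1) (top (m + n - 1) (u2 * v0 - u0 * v2))
        (m + n - 1) (top (m + n - 1) (u0 * v1 - u1 * v0))) ->
    a * u1 + b * u2 = K * u0 -> a * v1 + b * v2 = K * v0 + L * u0 ->
    deg_le (d - 1) K -> deg_le d a -> deg_le d b -> deg_le (d - 1) L ->
  exists x0 x1 x2,
    [/\ deg_le (d - m - n + 1) x0, deg_le (d - m - n) x1, deg_le (d - m - n) x2 &
      L = x0 * (u1 * v2 - u2 * v1) + x1 * (u2 * v0 - u0 * v2)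
          + x2 * (u0 * v1 - u1 * v0)].
Proof.
move=> m0 su0 du1 du2 dv0 dv1 dv2 eu tJ nzu nzuv nzm Xu Xv dK da db dL.
have du0 : deg_le m u0 by rewrite /deg_le su0 lexx orbT.
have u0n0 : u0 != 0.
  by apply: contra_eq_neq su0 => ->; rewrite msize0; move: m0; clear; lia.
(* [w] has degrees [be + m], [be + m - 1], [be + m - 1] *)
have [be beE] : exists be : int, be = d - 2 * m + 1 by exists (d - 2 * m + 1).
have cu : - K * u0 + a * u1 + b * u2 = 0 by rewrite -addrA Xu; ring.
have dc0 : deg_le (be + (m - 1) + (m - 1)) (- K).
  by rewrite deg_leN; apply: deg_leW dK; move: beE; clear; lia.
have dc1 : deg_le (be + (m - 1) + m) a by apply: deg_leW da; move: beE; clear; lia.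
have dc2 : deg_le (be + m + (m - 1)) b by apply: deg_leW db; move: beE; clear; lia.
have [w0 [w1 [w2 [[dw0 dw1 dw2] [c0 c1 c2]]]]] :=
  koszul du0 du1 du2 eu nzu cu dc0 dc1 dc2.
have Lu : L * u0 = (w1 * u2 - w2 * u1) * v0 + (w2 * u0 - w0 * u2) * v1
    + (w0 * u1 - w1 * u0) * v2.
  rewrite -c0 -c1 -c2.
  have -> : L * u0 = (K * v0 + L * u0) - K * v0 by ring.
  rewrite -Xv; ring.
(* [w0 * (u1 * v2 - u2 * v1)] lies in the ideal of [u0] and [v0]; hence so does
   [w0], as the second factor is invertible modulo this ideal *)
pose s := w0 * t1 - t2 * (w1 * u2 - w2 * u1).
pose t := w0 * t0 + t2 * (L - w2 * v1 + w1 * v2).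
have w0E : s * v0 + t * u0 = w0.
  rewrite -[RHS]mulr1 -tJ /s /t.
  have -> : (w0 * t1 - t2 * (w1 * u2 - w2 * u1)) * v0
     + (w0 * t0 + t2 * (L - w2 * v1 + w1 * v2)) * u0 =
     w0 * t1 * v0 - t2 * (w1 * u2 - w2 * u1) * v0 + w0 * t0 * u0
     + t2 * (L * u0) - t2 * (w2 * v1 - w1 * v2) * u0 by ring.
  rewrite Lu; ring.
have dst : deg_le (be - n + m + n) (s * v0 + t * u0).
  by rewrite w0E; apply: deg_leW dw0; clear; lia.
have [A [ds dt]] := reduce_pair du0 dv0 nzuv dst.
have {w0E dst} : (s - A * u0) * v0 + (t + A * v0) * u0 = w0 by rewrite -w0E; ring.
move: (s - A * u0) (t + A * v0) ds dt => {}s {}t ds dt w0E {A}.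
(* the vector [w - s v - t u] has the components 0, [z1], [z2] *)
pose z1 := w1 - s * v1 - t * u1; pose z2 := w2 - s * v2 - t * u2.
have dz (w u v : P) : deg_le (be + (m - 1)) w -> deg_le (m - 1) u -> deg_le (n - 1) v ->
    deg_le (be + (m - 1)) (w - s * v - t * u).
  move=> dw du dv; apply: deg_leB; first apply: deg_leB => //.
    by apply: deg_leM ds dv; clear; lia.
  by apply: deg_leM dt du; clear; lia.
have dz1 : deg_le (be + (m - 1)) z1 by apply: dz.
have dz2 : deg_le (be + (m - 1)) z2 by apply: dz.
pose h := z1 * u2 - z2 * u1.
have hv : h * v0 = (L - z2 * v1 + z1 * v2) * u0.
  have -> : (L - z2 * v1 + z1 * v2) * u0 = L * u0 - (z2 * v1 - z1 * v2) * u0 by ring.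
  rewrite Lu -w0E /h /z1 /z2; ring.
have [r hr] : exists r, h = r * u0.
  (* a relation between coprime forms, in a degree so low that the reduced
     coefficient of [v0] vanishes *)
  have : deg_le (- m - 1 + m + n) (h * v0 + - (L - z2 * v1 + z1 * v2) * u0).
    by rewrite hv mulNr subrr deg_le0.
  move=> /(reduce_pair du0 dv0 nzuv)[A [dA _]]; exists A; apply: subr0_eq.
  by apply: deg_le_neg dA; clear; lia.
have dr : deg_le (be + m - 2) r.
  apply: (@deg_le_cancel _ m _ u0 _ su0 m0); rewrite mulrC -hr; apply: deg_leB.
    by apply: deg_leM dz1 du2; clear; lia.
  by apply: deg_leM dz2 du1; clear; lia.
(* [(- r, - z2, z1)] is again orthogonal to [u], in a degree lower by [m] *)
have cz : - r * u0 + - z2 * u1 + z1 * u2 = 0 by rewrite mulNr -hr /h; ring.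
have dc0' : deg_le (be - m + (m - 1) + (m - 1)) (- r).
  by rewrite deg_leN; apply: deg_leW dr; clear; lia.
have dc1' : deg_le (be - m + (m - 1) + m) (- z2).
  by rewrite deg_leN; apply: deg_leW dz2; clear; lia.
have dc2' : deg_le (be - m + m + (m - 1)) z1 by apply: deg_leW dz1; clear; lia.
have [y0 [y1 [y2 [[dy0 dy1 dy2] [rE z2E z1E]]]]] :=
  koszul du0 du1 du2 eu nzu cz dc0' dc1' dc2'.
have LE : L = - y0 * (u1 * v2 - u2 * v1) + - y1 * (u2 * v0 - u0 * v2)
    + - y2 * (u0 * v1 - u1 * v0).
  apply: (mulIf u0n0).
  have -> : L * u0 = h * v0 + (z2 * v1 - z1 * v2) * u0 by rewrite hv; ring.
  rewrite hr -[r]opprK rE -[z2]opprK z2E z1E; ring.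
have {}dy0 : deg_le be (- y0) by rewrite deg_leN; apply: deg_leW dy0; clear; lia.
have {}dy1 : deg_le (be - 1) (- y1) by rewrite deg_leN; apply: deg_leW dy1; clear; lia.
have {}dy2 : deg_le (be - 1) (- y2) by rewrite deg_leN; apply: deg_leW dy2; clear; lia.
have [nm|mn] := leP n m.
  exists (- y0), (- y1), (- y2); split=> //.
  - by apply: deg_leW dy0; move: nm beE; clear; lia.
  - by apply: deg_leW dy1; move: nm beE; clear; lia.
  - by apply: deg_leW dy2; move: nm beE; clear; lia.
have [nzv nzM] := nzm mn.
have E0 : m + (n - m) = n by clear; lia.
have E1 : m - 1 + (n - m) = n - 1 by clear; lia.
have E2 : m - 1 + (m - 1) + (n - m) = m + n - 2 by clear; lia.
have E3 : m - 1 + m + (n - m) = m + n - 1 by clear; lia.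
have E4 : m + (m - 1) + (n - m) = m + n - 1 by clear; lia.
have := @reduce_det F (d - 2 * m - n + 1) (n - m) m (m - 1) (m - 1)
  u0 u1 u2 v0 v1 v2 (- y0) (- y1) (- y2).
rewrite -LE E0 E1 E2 E3 E4.
move=> /(_ du0 du1 du2 dv0 dv1 dv2 nzv nzM) [|A [B [l0 l1 l2]]].
  by apply: deg_leW dL; clear; lia.
exists (- y0 - A * u0 - B * v0), (- y1 - A * u1 - B * v1), (- y2 - A * u2 - B * v2).
split.
- by apply: deg_leW l0; clear; lia.
- by apply: deg_leW l1; clear; lia.
- by apply: deg_leW l2; clear; lia.
- rewrite [LHS]LE; ring.
Qed.
End Division.

(** * Homogenization and points at infinity *)

Section Homogenization.
Variable F : fieldType.
Local Notation P := (mpoly 2 F).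
Local Notation X i := (mpolyX F (mnm1 (i : 'I_3))).

Definition linear_extension (V : lmodType F) (h : multinom 2 -> V) (p : P) : V :=
  \sum_(m <- msupp p) mcoeff m p *: h m.

Lemma linear_extension_wide (V : lmodType F) (h : multinom 2 -> V) (p : P) k :
    (mpoly.msize p <= k)%N ->
  linear_extension h p = \sum_(m : bmultinom 2 k) mcoeff m p *: h m.
Proof.
move=> pk; rewrite /linear_extension (big_mksub (bmultinom 2 k)) ?msupp_uniq //=; last first.
  by move=> m /msize_mdeg_lt /leq_trans; apply.
rewrite big_rmcond //= => m /memN_msupp_eq0 ->; exact: scale0r.
Qed.

Lemma linear_extension_is_linear (V : lmodType F) (h : multinom 2 -> V) :
  linear (linear_extension h).
Proof.
move=> a p q.
pose k := maxn (mpoly.msize (a *: p + q)%R) (maxn (mpoly.msize p) (mpoly.msize q)).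
rewrite !(@linear_extension_wide _ _ _ k); try by rewrite /k; lia.
rewrite scaler_sumr -big_split; apply: eq_bigr => m _ /=.
by rewrite mcoeffD mcoeffZ scalerDl scalerA.
Qed.

HB.instance Definition _ (V : lmodType F) (h : multinom 2 -> V) :=
  GRing.isLinear.Build F P V *:%R (linear_extension h) (linear_extension_is_linear h).

Lemma linear_extensionX (V : lmodType F) (h : multinom 2 -> V) m :
  linear_extension h (mpolyX F m) = h m.
Proof. by rewrite /linear_extension msuppX big_seq1 mcoeffX eqxx scale1r. Qed.

Definition hom_monomial (D : nat) (m : multinom 2) : mpoly 3 F :=
  X 0 ^+ m 0 * X 1 ^+ m 1 * X 2%:R ^+ (D - mdeg m).

(** [z ^ D * p (x/z, y/z)] for [D] at least the degree of [p]. *)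
Definition hom (D : nat) : P -> mpoly 3 F := linear_extension (hom_monomial D).

HB.instance Definition _ D := GRing.Linear.on (hom D).

Lemma linear_mpoly_eq (V : lmodType F) (h1 h2 : {linear P -> V}) :
  (forall m, h1 (mpolyX F m) = h2 (mpolyX F m)) -> h1 =1 h2.
Proof.
by move=> h p; rewrite (mpolyE p) !linear_sum; apply: eq_bigr => m _; rewrite !linearZ h.
Qed.

Lemma meval_jacobian (f g : P) w :
  meval w (mderiv 0 f * mderiv 1 g - mderiv 1 f * mderiv 0 g) =
  meval w (mderiv 0 f) * meval w (mderiv 1 g)
    - meval w (mderiv 1 f) * meval w (mderiv 0 g).
Proof. by rewrite mevalB !mevalM. Qed.

Definition mon3 (m : multinom 2) k : multinom 3 := Multinom [tuple m 0; m 1; k].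

Lemma mon3E m k : [/\ mon3 m k 0 = m 0, mon3 m k 1 = m 1 & mon3 m k 2%:R = k].
Proof. by rewrite !multinomE !(tnth_nth 0%N). Qed.

Lemma forall_ord3 (Q : 'I_3 -> Prop) : Q 0 -> Q 1 -> Q 2%:R -> forall i, Q i.
Proof.
move=> Q0 Q1 Q2 [[|[|[|//]]] lti].
- by rewrite (_ : Ordinal lti = 0) //; apply: val_inj.
- by rewrite (_ : Ordinal lti = 1) //; apply: val_inj.
- by rewrite (_ : Ordinal lti = 2%:R) //; apply: val_inj.
Qed.

Lemma hom_monomialE D m : hom_monomial D m = mpolyX F (mon3 m (D - mdeg m)).
Proof.
have [e0 e1 e2] := mon3E m (D - mdeg m).
rewrite [RHS]mpolyXE_id !big_ord_recl big_ord0 mulr1.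
have -> : lift ord0 (lift ord0 ord0) = 2%:R :> 'I_3 by apply: val_inj.
have -> : lift ord0 ord0 = 1 :> 'I_3 by apply: val_inj.
by rewrite e0 e1 e2 /hom_monomial mulrA.
Qed.

Definition embed (i : 'I_2) : 'I_3 := if i == 0 then 0 else 1.

Lemma mderiv_hom D (i : 'I_2) p :
  mderiv (embed i) (hom D p) = hom D.-1 (mderiv i p).
Proof.
move: p; apply: (@linear_mpoly_eq _ (mderiv (embed i) \o hom D)
  (hom D.-1 \o mderiv i)) => m /=.
rewrite /hom linear_extensionX hom_monomialE !mderivX linearZ /=.
rewrite linear_extensionX hom_monomialE.
have -> : mon3 m (D - mdeg m) (embed i) = m i.
  have [e0 e1 _] := mon3E m (D - mdeg m).
  by move: i; apply: forall_ord2; rewrite /embed /= ?e0 ?e1.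
have [->|mi] := eqVneq (m i) 0%N; first by rewrite !scale0r.
congr (_ *: mpolyX _ _); apply/mnmP => j; rewrite mnmBE mnm1E.
have dm : mdeg (mnm_sub m (mnm1 i)) = (mdeg m).-1.
  rewrite !mdeg2 !mnmBE !mnm1E; move: i mi; apply: forall_ord2 => /=; lia.
rewrite dm; have dm0 : (0 < mdeg m)%N.
  by move: i mi {dm}; rewrite mdeg2; apply: forall_ord2 => /=; lia.
move: j; have [e0 e1 e2] := mon3E m (D - mdeg m).
have [f0 f1 f2] := mon3E (mnm_sub m (mnm1 i)) (D.-1 - (mdeg m).-1).
by apply: forall_ord3; rewrite ?e0 ?e1 ?e2 ?f0 ?f1 ?f2 ?mnmBE ?mnm1E;
  move: i mi {dm f0 f1 f2}; apply: forall_ord2; rewrite /embed //= => _; lia.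
Qed.

Lemma euler_hom D p : deg_le (Posz D) p ->
  \sum_i X i * mderiv i (hom D p) = D%:R *: hom D p.
Proof.
move=> dp; rewrite {1}(mpolyE p) [in RHS](mpolyE p) !linear_sum.
under eq_bigr => i _ do rewrite linear_sum mulr_sumr.
rewrite exchange_big [LHS]big_seq [RHS]big_seq /=.
apply: eq_bigr => m mp.
have {mp dp} mD : (mdeg m <= D)%N.
  by move/msize_mdeg_lt: mp; move: dp; rewrite /deg_le; lia.
rewrite linearZ /= scalerA mulrC -scalerA.
under eq_bigr => i _ do rewrite linearZ /= -scalerAr.
rewrite -scaler_sumr; congr (_ *: _).
have -> : hom D (mpolyX F m) = mpolyX F (mon3 m (D - mdeg m)).
  by rewrite /hom linear_extensionX hom_monomialE.
set k := mon3 _ _; have -> : D%:R = (\sum_i k i)%:R :> F.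
  congr _%:R.
  rewrite !big_ord_recl big_ord0 addn0.
  have -> : lift ord0 (lift ord0 ord0) = 2%:R :> 'I_3 by apply: val_inj.
  have -> : lift ord0 ord0 = 1 :> 'I_3 by apply: val_inj.
  by have [-> -> ->] := mon3E m (D - mdeg m); rewrite addnA -mdeg2 subnKC.
rewrite natr_sum scaler_suml; apply: eq_bigr => i _; rewrite mderivX -scalerAr.
have [->|ki] := eqVneq (k i) 0%N; first by rewrite !scale0r.
congr (_ *: _); rewrite -mpolyXD; congr mpolyX; apply/mnmP => j.
rewrite mnmDE mnmBE !mnm1E; case: eqVneq => [<-|_]; lia.
Qed.

Lemma euler_meval D p (v : 'I_3 -> F) : deg_le (Posz D) p ->
  v 0 * meval v (hom D.-1 (mderiv 0 p)) + v 1 * meval v (hom D.-1 (mderiv 1 p))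
    + v 2%:R * meval v (mderiv 2%:R (hom D p)) = D%:R * meval v (hom D p).
Proof.
move=> dp; have := congr1 (meval v) (euler_hom dp); rewrite mevalZ => <-.
rewrite -(mderiv_hom D 0) -(mderiv_hom D 1) !big_ord_recl big_ord0 addr0.
rewrite !rmorphD !rmorphM /= !mevalXU addrA.
have -> : lift ord0 (lift ord0 ord0) = 2%:R :> 'I_3 by apply: val_inj.
by have -> : lift ord0 ord0 = 1 :> 'I_3 by apply: val_inj.
Qed.

Lemma meval_hom_monomial v D m : meval v (hom_monomial D m) =
  v 0 ^+ m 0 * v 1 ^+ m 1 * v 2%:R ^+ (D - mdeg m).
Proof. by rewrite /hom_monomial !rmorphM !rmorphXn /= !mevalXU. Qed.

Lemma meval_hom v D p : meval v (hom D p) = \sum_(m <- msupp p)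
  mcoeff m p * (v 0 ^+ m 0 * v 1 ^+ m 1 * v 2%:R ^+ (D - mdeg m)).
Proof.
rewrite /hom /linear_extension rmorph_sum; apply: eq_bigr => m _.
by rewrite /= mevalZ meval_hom_monomial.
Qed.

Lemma meval_hom_affine (v : 'I_3 -> F) D p : v 2%:R = 1 ->
  meval v (hom D p) = meval (v \o embed) p.
Proof.
move=> v2; rewrite meval_hom mevalE; apply: eq_bigr => m _.
rewrite v2 expr1n mulr1 big_ord_recl big_ord1; congr (_ * (_ * _ ^+ m _)).
by apply: val_inj.
Qed.

(** Points of the line at infinity: [Some c] is the direction of [(c, 1)], and
    [None] that of [(1, 0)]. *)
Definition inf_point (s : option F) : 'I_3 -> F :=
  fun i => if i == 0 then odflt 1 s else if i == 1 then (s != None)%:R else 0.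

(** At the point [None] the form of degree [D] with dehomogenization [a] takes the
    value [a`_D], the coefficient of [x ^ D]. *)
Definition form_at (e : int) (a : {poly F}) (s : option F) : F :=
  match s, e with
  | Some c, _ => a.[c]
  | None, Posz D => a`_D
  | None, Negz _ => 0
  end.

Definition at_inf e (p : P) s := form_at e (top e p) s.

Lemma at_infE D p s : deg_le (Posz D) p ->
  at_inf (Posz D) p s = meval (inf_point s) (hom D p).
Proof.
move=> dp; have {}dp m : m \in msupp p -> (mdeg m <= D)%N.
  by move/msize_mdeg_lt; move: dp; rewrite /deg_le; lia.
rewrite meval_hom /at_inf /= coef_graded.
have -> : form_at D (\sum_(m <- msupp p | mdeg m == D) mcoeff m p *: 'X^(m 0)) s =
  \sum_(m <- msupp p | mdeg m == D) form_at D (mcoeff m p *: 'X^(m 0)) s.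
  by case: s => [c|] /=; rewrite ?horner_sum ?coef_sum.
rewrite big_mkcond big_seq [RHS]big_seq; apply: eq_bigr => m mp.
have -> : inf_point s 2%:R = 0 by [].
have := dp _ mp; rewrite leq_eqVlt => /predU1P[mD|lt]; last first.
  by rewrite ltn_eqF // expr0n subn_eq0 leqNgt lt /= !mulr0.
rewrite mD eqxx subnn expr0 mulr1; case: s => [c|] /=.
  by rewrite hornerZ hornerXn /inf_point /= expr1n mulr1.
rewrite coefZ coefXn /inf_point /= expr1n mul1r -mD mdeg2 expr0n.
congr (_ * (nat_of_bool _)%:R); lia.
Qed.

Lemma euler_infinity D p s : deg_le (Posz D) p -> meval (inf_point s) (hom D p) = 0 ->
  inf_point s 0 * meval (inf_point s) (mderiv 0 (hom D p))
    + inf_point s 1 * meval (inf_point s) (mderiv 1 (hom D p)) = 0.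
Proof.
move=> dp p0; have := euler_meval (inf_point s) dp; rewrite p0 mulr0.
rewrite (mderiv_hom D 0) (mderiv_hom D 1).
by have -> : inf_point s 2%:R = 0 by []; rewrite mul0r addr0.
Qed.

Lemma euler_affine D p (v : 'I_3 -> F) : v 2%:R = 1 -> deg_le (Posz D) p ->
    meval (v \o embed) p = 0 ->
  meval v (mderiv 2%:R (hom D p)) = - (v 0 * meval (v \o embed) (mderiv 0 p)
    + v 1 * meval (v \o embed) (mderiv 1 p)).
Proof.
move=> v2 dp p0; have := euler_meval v dp; rewrite !meval_hom_affine // p0 mulr0.
by rewrite v2 mul1r => /eqP; rewrite addr_eq0 => /eqP ->; rewrite opprK.
Qed.

Lemma at_infB e p q s : at_inf e (p - q) s = at_inf e p s - at_inf e q s.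
Proof.
rewrite /at_inf topB; case: s => [c|] /=; first by rewrite !hornerE.
by case: e => n /=; rewrite ?coefB ?subr0.
Qed.

Lemma at_inf0 e s : at_inf e 0 s = 0.
Proof. by rewrite -(subrr (0 : P)) at_infB subrr. Qed.

Lemma at_infM e e' e'' p q s : e'' = e + e' -> deg_le e p -> deg_le e' q ->
  at_inf e'' (p * q) s = at_inf e p s * at_inf e' q s.
Proof.
move=> -> dp dq; rewrite /at_inf (topM dp dq).
case: s => [c|]; first by rewrite /= hornerM.
have [e0|e0] := ltP e 0.
  rewrite (top_neg p e0) mul0r; case: (e + e') => n /=; rewrite ?coef0;
  by case: e e0 {dp} => //= n' _; rewrite mul0r.
have [e'0|e'0] := ltP e' 0.
  rewrite (top_neg q e'0) mulr0; case: (e + e') => n /=; rewrite ?coef0;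
  by case: e' e'0 {dq} => //= n' _; rewrite mulr0.
case: e e0 dp => // D _ dp; case: e' e'0 dq => // E _ dq.
rewrite /form_at -[D%:Z + E%:Z]/(Posz (D + E)).
apply: coefM_top => j Dj.
  by have /udeg_leP := udeg_le_top (Posz D) p; apply.
by have /udeg_leP := udeg_le_top (Posz E) q; apply.
Qed.
End Homogenization.

Lemma covector_multiple (F : fieldType) (a0 a1 b0 b1 : F) : a0 * b1 = a1 * b0 ->
  (b0 != 0) || (b1 != 0) -> exists c, a0 = c * b0 /\ a1 = c * b1.
Proof.
have [-> ab /= b1n|b0n ab _] := eqVneq b0 0.
  exists (a1 / b1); rewrite mulr0 divfK //; split=> //.
  by apply: (mulIf b1n); rewrite ab mulr0 mul0r.
exists (a0 / b0); rewrite divfK //; split=> //.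
by apply: (mulIf b0n); rewrite -ab mulrAC divfK.
Qed.

Lemma parallel_covectors (F : fieldType) (x y a0 a1 b0 b1 : F) :
    (x != 0) || (y != 0) -> x * a0 + y * a1 = 0 -> x * b0 + y * b1 = 0 ->
  a0 * b1 = a1 * b0.
Proof.
move=> /orP[] n0 ea eb; apply: (mulfI n0).
  have -> : x * (a0 * b1) = (x * a0 + y * a1) * b1 - y * a1 * b1 by ring.
  have -> : x * (a1 * b0) = (x * b0 + y * b1) * a1 - y * a1 * b1 by ring.
  by rewrite ea eb !mul0r.
have -> : y * (a0 * b1) = (x * b0 + y * b1) * a0 - x * a0 * b0 by ring.
have -> : y * (a1 * b0) = (x * a0 + y * a1) * b0 - x * a0 * b0 by ring.
by rewrite ea eb !mul0r.
Qed.

Section NoCommonZero.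
Variable F : closedFieldType.
Local Notation P := (mpoly 2 F).

Lemma no_common_zeroP e0 e1 e2 (p0 p1 p2 : P) :
    (forall s, ~~ [&& at_inf e0 p0 s == 0, at_inf e1 p1 s == 0 & at_inf e2 p2 s == 0]) ->
  no_common_zero e0 (top e0 p0) e1 (top e1 p1) e2 (top e2 p2).
Proof.
move=> nz; split=> [c|]; first exact: nz (Some c).
have fullE e (p : P) : at_inf e p None != 0 -> full e (top e p).
  rewrite /at_inf; case: e => [D|n] /=; last by rewrite eqxx.
  move=> pD; have := udeg_le_top (Posz D) p; rewrite udeg_le_nat /= => sp.
  have : size (graded p)`_D = D.+1.
    apply/eqP; rewrite eqn_leq sp ltnNge.
    by apply: contraNN pD => /(nth_default 0) ->.
  by rewrite /full => ->; lia.
have := nz None; rewrite !negb_and => /or3P[] /fullE ->; rewrite ?orbT //.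
Qed.

End NoCommonZero.

(** * Consequences of smoothness and transversality *)

Section NormalCrossings.
Variable C : closedFieldType.
Implicit Types (f g : mpoly 2 C) (G : mpoly 3 C) (Fs : seq (mpoly 3 C)).
Implicit Types (v : 'I_3 -> C) (p : 'rV[C]_3).

Definition gradient G p : 'rV[C]_3 := \row_i meval (p 0) (mderiv i G).

Definition differentials Fs p : seq 'rV[C]_3 :=
  [seq gradient G p | G <- Fs & meval (p 0) G == 0].

Definition line_at_infinity : mpoly 3 C := mpolyX C (mnm1 2%:R).

(** The condition [normal_crossings], over an arbitrary field. *)
Definition transverse Fs := forall p, p != 0 -> free (differentials Fs p).

Definition smooth f := forall w : 'I_2 -> C, meval w f = 0 ->
  (meval w (mderiv 0 f) != 0) || (meval w (mderiv 1 f) != 0).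

(** [z] stands for the differential of the equation of the line at infinity. *)
Lemma row3_decomposition (a b z : 'rV[C]_3) (c : C) :
    (forall i, z 0 i = (i == 2%:R)%:R) -> a 0 0 = c * b 0 0 -> a 0 1 = c * b 0 1 ->
  a = c *: b + (a 0 2%:R - c * b 0 2%:R) *: z.
Proof.
move=> zE a0 a1; apply/rowP => i; rewrite !mxE zE; move: i.
apply: forall_ord3; rewrite /= ?mulr0 ?addr0 ?mulr1 //.
by rewrite addrC subrK.
Qed.

Lemma transverse_tail G Fs :
  transverse (G :: Fs) -> transverse Fs.
Proof.
move=> nc p p0; have := nc p p0; rewrite /differentials /=; case: ifP => //= _.
by rewrite free_cons => /andP[].
Qed.

Lemma transverse_head G Fs p : transverse (G :: Fs) -> p != 0 ->
    meval (p 0) G = 0 ->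
  gradient G p \notin <<differentials Fs p>>%VS.
Proof.
move=> nc p0 Gp; have := nc p p0.
by rewrite /differentials /= Gp eqxx /= free_cons => /andP[].
Qed.

Lemma gradientE G v i : gradient G (\row_j v j) 0 i = meval v (mderiv i G).
Proof. by rewrite mxE; apply: meval_eq => j; rewrite mxE. Qed.

Lemma gradient_infinity p (i : 'I_3) : gradient (line_at_infinity) p 0 i = (i == 2%:R)%:R.
Proof.
rewrite mxE mderivX mnm1E eq_sym; case: eqVneq => [->|_]; last first.
  by rewrite scale0r meval0.
rewrite scale1r mevalX big1 // => j _.
by rewrite mnmBE subnn expr0.
Qed.

Lemma row_inf_point_neq0 (s : option C) : \row_j inf_point s j != 0 :> 'rV_3.
Proof.
apply/eqP => /rowP e; case: s e => [c|] e.
  by have := e 1; rewrite !mxE /= => /eqP; rewrite oner_eq0.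
by have := e 0; rewrite !mxE /= => /eqP; rewrite oner_eq0.
Qed.

Lemma meval_row G v : meval ((\row_j v j : 'rV_3) 0) G = meval v G.
Proof. by apply: meval_eq => j; rewrite mxE. Qed.

Lemma mem_differentials G Fs p : G \in Fs -> meval (p 0) G = 0 ->
  gradient G p \in <<differentials Fs p>>%VS.
Proof.
by move=> GF Gp; apply/memv_span/map_f; rewrite mem_filter Gp eqxx.
Qed.

Lemma inf_point_on_line (s : option C) :
  meval ((\row_j inf_point s j : 'rV_3) 0) (line_at_infinity) = 0.
Proof. by rewrite meval_row mevalXU. Qed.

(** At a double zero of the leading form, the differential of the homogenized
    equation is a multiple of that of the line at infinity. *)
Lemma smooth_at_infinity f Fs (m : nat) : mpoly.msize f = m.+2 ->
    transverse (hom m.+1 f :: Fs) -> line_at_infinity \in Fs ->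
  forall s, ~~ [&& at_inf (Posz m.+1) f s == 0,
    at_inf (Posz m) (mderiv 0 f) s == 0 & at_inf (Posz m) (mderiv 1 f) s == 0].
Proof.
move=> sf nc zF s.
have df : deg_le (Posz m.+1) f by rewrite /deg_le sf; lia.
rewrite (at_infE s df) !(at_infE s (deg_le_mderivS _ df)).
apply/negP => /and3P[/eqP f0 /eqP f1 /eqP f2].
have := transverse_head nc (row_inf_point_neq0 s); rewrite meval_row => /(_ f0).
case/negP; set p := \row_j _.
rewrite (@row3_decomposition (gradient (hom m.+1 f) p) 0 _ 0
  (gradient_infinity p)); last 2 first.
- by rewrite mul0r gradientE (mderiv_hom _ 0) f1.
- by rewrite mul0r gradientE (mderiv_hom _ 1) f2.
rewrite scale0r add0r; apply: memvZ.
by apply: mem_differentials zF _; apply: inf_point_on_line.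
Qed.

(** At a common point of [f], [g] and the line at infinity, the differentials of
    the three equations annihilate the vector of homogeneous coordinates, hence
    are dependent. *)
Lemma no_common_point_at_infinity f g Fs (m n : nat) :
    mpoly.msize f = m.+2 -> mpoly.msize g = n.+1 ->
    transverse [:: hom m.+1 f, hom n g, line_at_infinity & Fs] ->
  forall s, ~~ [&& at_inf (Posz m.+1) f s == 0, at_inf (Posz n) g s == 0
    & at_inf 0 0 s == 0].
Proof.
move=> sf sg nc s.
have df : deg_le (Posz m.+1) f by rewrite /deg_le sf; lia.
have dg : deg_le (Posz n) g by rewrite /deg_le sg; lia.
rewrite (at_infE s df) (at_infE s dg); apply/negP => /and3P[/eqP f0 /eqP g0 _].
case: n => [|n] in sg dg g0 nc *.
  move: g0; have /eqP/msize_poly1P[c c0 ->] := sg.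
  rewrite meval_hom msuppC (negPf c0) big_seq1 mcoeffC eqxx mulr1.
  rewrite !mnm0E mdeg0 subn0 !expr0 !mulr1 => c0'; move: c0.
  by rewrite c0' eqxx.
have := transverse_head nc (row_inf_point_neq0 s).
rewrite meval_row => /(_ f0); case/negP; set p := \row_j _.
set T := [:: hom n.+1 g, _ & _].
have pn0 := row_inf_point_neq0 s.
have gT : gradient (hom n.+1 g) p \in <<differentials T p>>%VS.
  by apply: mem_differentials (mem_head _ _) _; rewrite meval_row.
have zT : gradient (line_at_infinity) p \in <<differentials T p>>%VS.
  apply: mem_differentials; last exact: inf_point_on_line.
  by rewrite in_cons mem_head orbT.
have ef : inf_point s 0 * gradient (hom m.+1 f) p 0 0
    + inf_point s 1 * gradient (hom m.+1 f) p 0 1 = 0.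
  by rewrite !gradientE; apply: euler_infinity.
have eg : inf_point s 0 * gradient (hom n.+1 g) p 0 0
    + inf_point s 1 * gradient (hom n.+1 g) p 0 1 = 0.
  by rewrite !gradientE; apply: euler_infinity.
have [c [c0 c1]] : exists c,
    gradient (hom m.+1 f) p 0 0 = c * gradient (hom n.+1 g) p 0 0 /\
    gradient (hom m.+1 f) p 0 1 = c * gradient (hom n.+1 g) p 0 1.
  apply: covector_multiple.
    apply: parallel_covectors ef eg.
    by case: (s) => [a|]; rewrite /inf_point /= oner_eq0 ?orbT.
  have nc' := transverse_tail nc.
  have := smooth_at_infinity sg nc' (mem_head _ _) s.
  rewrite (at_infE s dg) !(at_infE s (deg_le_mderivS _ dg)).
  rewrite !gradientE (mderiv_hom _ 0) (mderiv_hom _ 1).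
  by rewrite negb_and g0 eqxx /= negb_and.
rewrite (row3_decomposition (gradient_infinity p) c0 c1).
exact: memvD (memvZ _ gT) (memvZ _ zT).
Qed.

(** At a common point of [f] and [g], Euler's relation determines the last
    component of the differential of either homogenized equation by the two
    others, so that a vanishing Jacobian makes these differentials
    dependent. *)
Lemma jacobian_neq0 f g Fs (m n : nat) (w : 'I_2 -> C) :
    deg_le (Posz m) f -> deg_le (Posz n) g ->
    transverse [:: hom m f, hom n g & Fs] -> smooth g ->
  ~~ [&& meval w f == 0, meval w g == 0 &
    meval w (mderiv 0 f * mderiv 1 g - mderiv 1 f * mderiv 0 g) == 0].
Proof.
move=> df dg nc ns; apply/negP => /and3P[/eqP f0 /eqP g0].
rewrite meval_jacobian => /eqP J0.
pose v (i : 'I_3) : C := if i == 0 then w 0 else if i == 1 then w 1 else 1.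
have vw : v \o embed =1 w by apply: forall_ord2.
have aff (D : nat) (h : mpoly 2 C) : meval v (hom D h) = meval w h.
  by rewrite meval_hom_affine; [apply: meval_eq|].
have pn0 : \row_j v j != 0 :> 'rV_3.
  by apply/eqP => /rowP/(_ 2%:R); rewrite !mxE /v /= => /eqP; rewrite oner_eq0.
have := transverse_head nc pn0; rewrite meval_row.
rewrite aff => /(_ f0).
case/negP; set p := \row_j _; set T := hom n g :: Fs.
have gT : gradient (hom n g) p \in <<differentials T p>>%VS.
  by apply: mem_differentials; [exact: mem_head|rewrite meval_row aff].
have grad0 D h : gradient (hom D h) p 0 0 = meval w (mderiv 0 h).
  by rewrite gradientE (mderiv_hom D 0) aff.
have grad1 D h : gradient (hom D h) p 0 1 = meval w (mderiv 1 h).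
  by rewrite gradientE (mderiv_hom D 1) aff.
have grad2 (D : nat) (h : mpoly 2 C) : deg_le (Posz D) h -> meval w h = 0 ->
    gradient (hom D h) p 0 2%:R =
    - (w 0 * meval w (mderiv 0 h) + w 1 * meval w (mderiv 1 h)).
  move=> dh h0; rewrite gradientE (@euler_affine _ _ _ v) ?(meval_eq _ vw) //.
have [c [c0 c1]] : exists c,
    meval w (mderiv 0 f) = c * meval w (mderiv 0 g) /\
    meval w (mderiv 1 f) = c * meval w (mderiv 1 g).
  apply: covector_multiple; first by apply/eqP; rewrite -subr_eq0 J0.
  exact: ns.
have -> : gradient (hom m f) p = c *: gradient (hom n g) p.
  apply/rowP; apply: forall_ord3; rewrite [RHS]mxE.
  - by rewrite !grad0.
  - by rewrite !grad1.
  - by rewrite !grad2 // c0 c1; ring.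
exact: memvZ.
Qed.

(** By Euler's relation, [x] times the third minor minus [y] times the second one
    is [(deg g - deg f) f g] for the leading forms.  At a common zero of the
    minors, one of the forms thus vanishes, and this point is then a double zero
    of it or a zero of the other one. *)
Lemma minors_at_infinity f g Fs (m n : nat) :
    mpoly.msize f = m.+2 -> mpoly.msize g = n.+2 -> [pchar C] =i pred0 -> (m < n)%N ->
    transverse [:: hom m.+1 f, hom n.+1 g, line_at_infinity & Fs] ->
  forall s, ~~ [&&
    at_inf (Posz (m + n)) (mderiv 0 f * mderiv 1 g - mderiv 1 f * mderiv 0 g) s == 0,
    at_inf (Posz (m + n).+1) (mderiv 1 f * g - f * mderiv 1 g) s == 0 &
    at_inf (Posz (m + n).+1) (f * mderiv 0 g - mderiv 0 f * g) s == 0].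
Proof.
move=> sf sg ch mn nc s.
have df : deg_le (Posz m.+1) f by rewrite /deg_le sf; lia.
have dg : deg_le (Posz n.+1) g by rewrite /deg_le sg; lia.
have df0 := deg_le_mderivS 0 df; have df1 := deg_le_mderivS 1 df.
have dg0 := deg_le_mderivS 0 dg; have dg1 := deg_le_mderivS 1 dg.
have sm_f := smooth_at_infinity sf nc ltac:(by rewrite in_cons mem_head orbT) s.
have sm_g := smooth_at_infinity sg (transverse_tail nc) (mem_head _ _) s.
have := no_common_point_at_infinity sf sg nc s; rewrite at_inf0 eqxx andbT => fg.
rewrite !at_infB (at_infM s _ df0 dg1) // (at_infM s _ df1 dg0) //.
rewrite (at_infM s _ df1 dg) ?(at_infM s _ df dg1) ?(at_infM s _ df dg0)
  ?(at_infM s _ df0 dg); try by clear; lia.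
have ef : inf_point s 0 * at_inf (Posz m) (mderiv 0 f) s
    + inf_point s 1 * at_inf (Posz m) (mderiv 1 f) s = m.+1%:R * at_inf (Posz m.+1) f s.
  rewrite (at_infE s df) (at_infE s df0) (at_infE s df1).
  have := euler_meval (inf_point s) df.
  by have -> : inf_point s 2%:R = 0 by []; rewrite mul0r addr0.
have eg : inf_point s 0 * at_inf (Posz n) (mderiv 0 g) s
    + inf_point s 1 * at_inf (Posz n) (mderiv 1 g) s = n.+1%:R * at_inf (Posz n.+1) g s.
  rewrite (at_infE s dg) (at_infE s dg0) (at_infE s dg1).
  have := euler_meval (inf_point s) dg.
  by have -> : inf_point s 2%:R = 0 by []; rewrite mul0r addr0.
move: sm_f sm_g fg ef eg.
move: (at_inf _ f s) (at_inf _ g s) (at_inf _ (mderiv 0 f) s) (at_inf _ (mderiv 1 f) s)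
  (at_inf _ (mderiv 0 g) s) (at_inf _ (mderiv 1 g) s) (inf_point s 0) (inf_point s 1).
move=> a b a0 a1 b0 b1 x y.
move=> sa sb ab ea eb; apply/negP => /and3P[/eqP J /eqP q /eqP p].
have [a_0|a_n] := eqVneq a 0.
  move: sa ab q p; rewrite a_0 eqxx /= !mul0r subr0 sub0r => sa b_n /eqP + /eqP.
  rewrite oppr_eq0 !mulf_eq0 (negPf b_n) !orbF => /eqP a1_0 /eqP a0_0.
  by case/negP: sa; rewrite a1_0 a0_0 eqxx.
have [b_0|b_n] := eqVneq b 0.
  move: sb q p; rewrite b_0 eqxx /= !mulr0 subr0 sub0r => sb /eqP + /eqP.
  rewrite oppr_eq0 !mulf_eq0 (negPf a_n) /= => /eqP b1_0 /eqP b0_0.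
  by case/negP: sb; rewrite b1_0 b0_0 eqxx.
have nm : n.+1%:R - m.+1%:R != 0 :> C.
  rewrite -natrB; last by rewrite ltnS ltnW.
  by move/pcharf0P: ch => ->; rewrite subSS subn_eq0 -ltnNge.
have /negP[] := mulf_neq0 nm (mulf_neq0 a_n b_n).
have -> : (n.+1%:R - m.+1%:R) * (a * b) =
  a * (n.+1%:R * b) - b * (m.+1%:R * a) by ring.
rewrite -ea -eb.
have -> : a * (x * b0 + y * b1) - b * (x * a0 + y * a1) =
  x * (a * b0 - a0 * b) - y * (a1 * b - a * b1) by ring.
by rewrite p q !mulr0 subrr.
Qed.

Lemma jacobian_unit f g Fs (m n : nat) : f != 0 -> deg_le (Posz m) f -> deg_le (Posz n) g ->
    transverse [:: hom m f, hom n g & Fs] -> smooth g ->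
  exists t0 t1 t2, t0 * f + t1 * g
    + t2 * (mderiv 0 f * mderiv 1 g - mderiv 1 f * mderiv 0 g) = 1.
Proof.
move=> f0 df dg nc smg; apply: nullstellensatz3 => // w.
exact: jacobian_neq0 df dg nc smg.
Qed.

(** The field is [f g (x2, - x1) + x0 g (- f_y, f_x)], where [x0], [x1], [x2]
    are the coefficients of [L] on the minors. *)
Lemma logarithmic_field f g (m n d : nat) (K L a b : mpoly 2 C) :
    [pchar C] =i pred0 -> mpoly.msize f = m.+2 -> mpoly.msize g = n.+1 ->
    smooth f -> smooth g -> transverse [:: hom m.+1 f; hom n g; line_at_infinity] ->
    a * mderiv 0 f + b * mderiv 1 f = K * f ->
    a * mderiv 0 g + b * mderiv 1 g = K * g + L * f ->
    deg_le (Posz d - 1) K -> deg_le (Posz d) a -> deg_le (Posz d) b -> deg_le (Posz d - 1) L ->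
  exists z1 z2 M N, [/\ z1 * mderiv 0 f + z2 * mderiv 1 f = M * f,
    z1 * mderiv 0 g + z2 * mderiv 1 g = N * g, N - M = L,
    deg_le (Posz d) z1 & deg_le (Posz d) z2].
Proof.
move=> ch sf sg smf smg nc Xf Xg dK da db dL.
have df : deg_le (Posz m.+1) f by rewrite /deg_le sf; lia.
have dg : deg_le (Posz n) g by rewrite /deg_le sg; lia.
have m1 : m.+1%:Z - 1 = Posz m by clear; lia.
have f_neq0 : f != 0 by rewrite -msize_gt0 sf.
have sizef : (mpoly.msize f)%:Z = Posz m.+1 + 1 by rewrite sf; clear; lia.
have dfi (i : 'I_2) : deg_le (m.+1%:Z - 1) (mderiv i f) by apply: deg_le_mderiv.
have dgi (i : 'I_2) : deg_le (n%:Z - 1) (mderiv i g) by apply: deg_le_mderiv.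
have [e0 [e1 [e2 eu]]] : exists e0 e1 e2,
    e0 * f + e1 * mderiv 0 f + e2 * mderiv 1 f = 1.
  apply: nullstellensatz3 => // w; apply/negP => /and3P[/eqP fw f0 f1].
  by have := smf w fw; rewrite f0 f1.
have [t0 [t1 [t2 tJ]]] := jacobian_unit f_neq0 df dg nc smg.
have nzf : no_common_zero m.+1 (top m.+1 f) (m.+1%:Z - 1) (top (m.+1%:Z - 1) (mderiv 0 f))
    (m.+1%:Z - 1) (top (m.+1%:Z - 1) (mderiv 1 f)).
  rewrite m1; apply: no_common_zeroP; apply: smooth_at_infinity sf nc _.
  by rewrite in_cons mem_head orbT.
have nzfg : no_common_zero m.+1 (top m.+1 f) n (top n g) 0 0.
  have := no_common_zeroP (no_common_point_at_infinity sf sg nc).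
  by rewrite top0.
have [|x0 [x1 [x2 [dx0 dx1 dx2 LE]]]] := @cofactor_in_minors C m.+1 n d f (mderiv 0 f)
    (mderiv 1 f) g (mderiv 0 g) (mderiv 1 g) e0 e1 e2 t0 t1 t2 K a b L isT sizef (dfi 0)
    (dfi 1) dg (dgi 0) (dgi 1) eu tJ nzf nzfg _ Xf Xg dK da db dL.
  case: n sg dg dgi nc {tJ nzfg} => [|n] sg dg dgi nc mn; first by lia.
  have n1 : n.+1%:Z - 1 = Posz n by clear; lia.
  have E2 : m.+1%:Z + n.+1%:Z - 2 = Posz (m + n) by clear; lia.
  have E1 : m.+1%:Z + n.+1%:Z - 1 = Posz (m + n).+1 by clear; lia.
  rewrite n1 E1 E2; split.
    apply: no_common_zeroP.
    exact: smooth_at_infinity sg (transverse_tail nc) (mem_head _ _).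
  by apply/no_common_zeroP/(minors_at_infinity sf sg ch _ nc).
exists (f * g * x2 - x0 * g * mderiv 1 f), (x0 * g * mderiv 0 f - f * g * x1).
exists (g * (x2 * mderiv 0 f - x1 * mderiv 1 f)).
exists (f * (x2 * mderiv 0 g - x1 * mderiv 1 g)
  + x0 * (mderiv 0 f * mderiv 1 g - mderiv 1 f * mderiv 0 g)).
have dfg : deg_le (m.+1%:Z + n%:Z) (f * g) by apply: deg_leM df dg.
have dx0g : deg_le (d%:Z - m.+1%:Z + 1) (x0 * g) by apply: deg_leM dx0 dg; clear; lia.
split.
- ring.
- ring.
- rewrite [RHS]LE; ring.
- apply: deg_leB; first by apply: deg_leM dfg dx2; clear; lia.
  by apply: deg_leM dx0g (dfi 1); clear; lia.
- apply: deg_leB; last by apply: deg_leM dfg dx1; clear; lia.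
  by apply: deg_leM dx0g (dfi 0); clear; lia.
Qed.

End NormalCrossings.

(** * Complex derivatives *)

Section ComplexDerivatives.
Local Open Scope classical_set_scope.

Lemma is_derive_chain (K : numFieldType) (e q : K -> K) (x de dq : K) :
    is_derive x 1 q dq -> is_derive (q x) 1 e de ->
  is_derive x 1 (e \o q) (de * dq).
Proof.
move=> hq he.
have dfq : differentiable q x.
  by apply/derivable1_diffP; apply: (@ex_derive _ _ _ _ _ _ _ hq).
have dfe : differentiable e (q x).
  by apply/derivable1_diffP; apply: (@ex_derive _ _ _ _ _ _ _ he).
have dfeq : differentiable (e \o q) x by apply: differentiable_comp.
apply: DeriveDef; first exact/derivable1_diffP.
have <- : e^`()%classic (q x) = de by rewrite derive1E derive_val.
have <- : q^`()%classic x = dq by rewrite derive1E derive_val.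
rewrite -derive1E derive1E' // diff_comp // !derive1E' //=.
by rewrite -[X in 'd _ _ X = _]mulr1 [LHS]linearZ mulrC.
Qed.

Lemma mpoly2_ind (K : comNzRingType) (Q : mpoly 2 K -> Prop) :
    (forall c, Q (mpolyC 2 c)) -> (forall i, Q (mpolyX K (mnm1 i))) ->
    (forall p q, Q p -> Q q -> Q (p + q)) -> (forall p q, Q p -> Q q -> Q (p * q)) ->
  forall p, Q p.
Proof.
move=> QC QX QD QM p; rewrite (mpolyE p).
apply: big_ind => [||m _]; [by rewrite -mpolyC0|exact: QD|].
rewrite -mul_mpolyC; apply: (QM) => //; rewrite mpolyXE_id.
apply: big_ind => [||i _]; [by rewrite -mpolyC1|exact: QM|].
by elim: (m i) => [|k IH]; [rewrite expr0 -mpolyC1|rewrite exprS; apply: QM].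
Qed.

(** The hypothesis says that [v] moves with unit speed along the coordinate
    [i]. *)
Lemma is_derive_meval (K : numFieldType) (v : K -> 'I_2 -> K) (i : 'I_2) (t : K) :
    (forall j, is_derive t 1 (fun z => v z j) (j == i)%:R) ->
  forall p : mpoly 2 K, is_derive t 1 (fun z => meval (v z) p) (meval (v t) (mderiv i p)).
Proof.
move=> dv; apply: mpoly2_ind => [c|j|p q dp dq|p q dp dq].
- have -> : (fun z => meval (v z) (mpolyC 2 c)) = cst c.
    by apply/funext => z; rewrite mevalC.
  by rewrite mderivC meval0; apply: is_derive_cst.
- have -> : (fun z => meval (v z) (mpolyX K (mnm1 j))) = (fun z => v z j).
    by apply/funext => z; rewrite mevalXU.
  rewrite mderivX mnm1E; have := dv j; case: eqVneq => [->|_]; last first.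
    by rewrite scale0r meval0.
  by rewrite scale1r mevalX big1 // => k _; rewrite mnmBE subnn expr0.
- have -> : (fun z => meval (v z) (p + q)) =
      (fun z => meval (v z) p) + (fun z => meval (v z) q).
    by apply/funext => z; rewrite mevalD.
  by rewrite mderivD mevalD; apply: is_deriveD.
have -> : (fun z => meval (v z) (p * q)) =
    (fun z => meval (v z) p) * (fun z => meval (v z) q).
  by apply/funext => z; rewrite mevalM.
apply: (is_derive_eq (is_deriveM dp dq)).
by rewrite mderivM mevalD !mevalM addrC [in RHS]mulrC.
Qed.

Lemma is_derive_quotient (K : numFieldType) (g f : K -> K) (x dg df : K) :
    f x != 0 -> is_derive x 1 g dg -> is_derive x 1 f df ->
  is_derive x 1 (fun z => g z / f z) ((f x * dg - g x * df) / f x ^+ 2).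
Proof.
move=> fx hg hf.
have hV : is_derive x 1 (fun z => (f z)^-1) (- (f x) ^- 2 *: df).
  apply: DeriveDef; first exact: derivableV.
  by rewrite deriveV // derive_val.
apply: (is_derive_eq (is_deriveM hg hV)).
by rewrite /GRing.scale /=; field.
Qed.

End ComplexDerivatives.

(** * The derivative of the complex exponential *)

Section ComplexExponential.
Local Open Scope classical_set_scope.
Local Open Scope complex_scope.
Variable R : realType.

Lemma derive_error (f : R -> R) (l e : R) : is_derive (0 : R) 1 f l -> 0 < e ->
  exists2 d : R, 0 < d & forall a, `|a| < d -> `|f a - f 0 - l * a| <= e * `|a|.
Proof.
move=> hf e0; have df : derivable f 0 1 by apply: ex_derive.
have : (fun h : R => h^-1 *: ((f \o shift 0) (h *: 1) - f 0)) @ 0^' --> l.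
  by have <- : 'D_1 f 0 = l by exact: derive_val.
move=> /cvgrPdist_le/(_ _ e0).
rewrite near_withinE => /nbhs_ballP[d /= d0 hd]; exists d => // a ad.
have [->|a0] := eqVneq a 0; first by rewrite subrr mulr0 subrr normr0 mulr0.
have := hd a; rewrite /ball /= sub0r normrN => /(_ ad a0).
rewrite /= addr0 [_%:A]mulr1 => h.
have -> : f a - f 0 - l * a = - a * (l - a^-1 * (f a - f 0)).
  by field.
by rewrite normrM normrN mulrC ler_wpM2r.
Qed.

Lemma norm_complexE (a b : R) : `|(a +i* b : CC R)| = (Num.sqrt (a ^+ 2 + b ^+ 2))%:C.
Proof. exact: normc_def. Qed.

Lemma norm_complex_le (a b : R) : Num.sqrt (a ^+ 2 + b ^+ 2) <= `|a| + `|b|.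
Proof.
rewrite -[leRHS]ger0_norm ?addr_ge0 // -sqrtr_sqr ler_wsqrtr //.
rewrite sqrrD !real_normK ?num_real // addrAC lerDl mulrn_wge0 ?mulr_ge0 //.
Qed.

Lemma le_norm_complex (a b : R) :
  `|a| <= Num.sqrt (a ^+ 2 + b ^+ 2) /\ `|b| <= Num.sqrt (a ^+ 2 + b ^+ 2).
Proof.
by rewrite -!sqrtr_sqr; split; apply: ler_wsqrtr; rewrite ?lerDl ?lerDr sqr_ge0.
Qed.

(** For [h = a + i b], the real and imaginary parts of [cexp h - 1 - h] are
    [(exp a - 1 - a) + exp a (cos b - 1)] and
    [exp a (sin b - b) + (exp a - 1) b]; each is at most [3 e' |h|] for small
    [h], where [e' <= e / 8]. *)
Lemma cexp_error (e : R) : 0 < e -> exists2 d : R, 0 < d & forall h : CC R,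
  `|h| < (d%:C : CC R) -> `|cexp h - 1 - h| <= (e%:C : CC R) * `|h|.
Proof.
move=> e0; pose e' := Num.min (e / 8) 1.
have e'0 : 0 < e' by rewrite lt_min ltr01 divr_gt0.
have he8 : e' <= e / 8 by rewrite ge_min lexx.
have he1 : e' <= 1 by rewrite ge_min lexx orbT.
have [d1 d10 h1] := derive_error (is_derive_expR 0) e'0.
have [d2 d20 h2] := derive_error (is_derive_sin 0) e'0.
have [d3 d30 h3] := derive_error (is_derive_cos 0) e'0.
pose d := Num.min (Num.min d1 (e' / 2)) (Num.min d2 d3).
exists d; first by rewrite !lt_min d10 d20 d30 divr_gt0.
case=> a b; rewrite norm_complexE ltcR /cexp => hd.
have [al bl] := le_norm_complex a b.
set r := Num.sqrt _ in hd al bl.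
have ad := le_lt_trans al hd; have bd := le_lt_trans bl hd.
move: ad bd; rewrite !lt_min => /andP[/andP[a1 ae] _] /andP[_ /andP[b2 b3]].
have := h1 a a1; have := h2 b b2; have := h3 b b3.
rewrite expR0 sin0 cos0 oppr0 mul0r !subr0 ?addr0 !mul1r => c s x.
have r0 : 0 <= r by apply: sqrtr_ge0.
have ea : e' * `|a| <= `|a| by rewrite ler_piMl.
have era : e' * `|a| <= e' * r by rewrite ler_wpM2l // ltW.
have erb : e' * `|b| <= e' * r by rewrite ler_wpM2l // ltW.
have er0 : 0 <= e * r by rewrite mulr_ge0 // ltW.
have er8 : e' * r <= e / 8 * r by rewrite ler_wpM2r.
have A2 : `|expR a - 1| <= 2 * `|a|.
  have -> : expR a - 1 = (expR a - 1 - a) + a by ring.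
  by apply: le_trans (ler_normD _ _) _; lra.
have A1 : `|expR a| <= 2.
  have -> : expR a = (expR a - 1) + 1 by ring.
  by apply: le_trans (ler_normD _ _) _; rewrite normr1; lra.
have u3 : `|expR a * cos b - 1 - a| <= 3 * e' * r.
  have -> : expR a * cos b - 1 - a = (expR a - 1 - a) + expR a * (cos b - 1) by ring.
  apply: le_trans (ler_normD _ _) _; rewrite normrM.
  have : `|expR a| * `|cos b - 1| <= 2 * (e' * `|b|) by apply: ler_pM.
  by lra.
have v3 : `|expR a * sin b - b| <= 3 * e' * r.
  have -> : expR a * sin b - b = expR a * (sin b - b) + (expR a - 1) * b by ring.
  apply: le_trans (ler_normD _ _) _; rewrite !normrM.
  have : `|expR a| * `|sin b - b| <= 2 * (e' * `|b|) by apply: ler_pM.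
  have : `|expR a - 1| * `|b| <= e' * `|b| by apply: ler_wpM2r => //; lra.
  by lra.
have -> : (expR a * cos b +i* (expR a * sin b) : CC R) - 1 - (a +i* b) =
    (expR a * cos b - 1 - a) +i* (expR a * sin b - b).
  by apply/eqP; rewrite eq_complex /= subr0 !eqxx.
rewrite norm_complexE.
have : Num.sqrt ((expR a * cos b - 1 - a) ^+ 2 + (expR a * sin b - b) ^+ 2) <= e * r.
  by apply: le_trans (norm_complex_le _ _) _; lra.
by rewrite -lecR rmorphM.
Qed.

Lemma cexpD (z w : CC R) : cexp (z + w) = cexp z * cexp w.
Proof.
case: z w => [a b] [c d]; rewrite /cexp /= expRD cosD sinD.
by apply/eqP; rewrite eq_complex /=; apply/andP; split; apply/eqP; ring.
Qed.

Lemma cexp_neq0 (z : CC R) : cexp z != 0.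
Proof.
suff : cexp z * cexp (- z) != 0 by apply: contraNneq => ->; rewrite mul0r.
rewrite -cexpD subrr (_ : cexp 0 = 1) ?oner_eq0 //.
by rewrite /cexp /= expR0 cos0 sin0 mulr1 mulr0.
Qed.

Lemma is_derive_cexp (z : CC R) : is_derive z 1 (@cexp R) (cexp z).
Proof.
have h0 : (fun h : CC R => h^-1 *: ((@cexp R \o shift z) (h *: 1) - cexp z)) @ 0^'
    --> cexp z.
  have -> : (fun h : CC R => h^-1 *: ((@cexp R \o shift z) (h *: 1) - cexp z)) =
      (fun h : CC R => cexp z * (h^-1 * (cexp h - 1))).
    apply/funext => h /=; rewrite [h *: 1]mulr1 cexpD /GRing.scale /=; ring.
  rewrite -[X in _ --> X]mulr1; apply: cvgM; first exact: cvg_cst.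
  apply/cvgrPdist_le => -[e e'] /=; rewrite ltcE /= => /andP[/eqP -> e0].
  have [d d0 hd] := cexp_error e0.
  rewrite near_withinE; apply/nbhs_ballP; exists (d%:C : CC R); first by rewrite /= ltcR.
  move=> h; rewrite /ball /= sub0r normrN => /hd dh hn0.
  have -> : 1 - h^-1 * (cexp h - 1) = - (h^-1 * (cexp h - 1 - h)).
    by field.
  rewrite normrN normrM normfV mulrC ler_pdivrMr ?normr_gt0 //.
by apply: DeriveDef; [apply: cvgP h0|apply: cvg_lim h0].
Qed.
End ComplexExponential.

(** * The equation of an exponential factor *)

Section ExponentialFactor.
Local Open Scope classical_set_scope.
Variable R : realType.
Implicit Types (X : vfield R) (f g K L : poly2 R).

Lemma derive_exp_quot (v : CC R -> 'I_2 -> CC R) (i : 'I_2) (t : CC R) f g :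
    (forall j, is_derive t 1 (fun z => v z j) (j == i)%:R) -> meval (v t) f != 0 ->
  derive1 (fun z => cexp (meval (v z) g / meval (v z) f)) t =
    cexp (meval (v t) g / meval (v t) f) *
    ((meval (v t) f * meval (v t) (mderiv i g) - meval (v t) g * meval (v t) (mderiv i f))
       / meval (v t) f ^+ 2).
Proof.
move=> dv fn0.
have dq := is_derive_quotient fn0 (is_derive_meval dv g) (is_derive_meval dv f).
have dc := is_derive_chain dq (is_derive_cexp _).
by rewrite derive1E; apply: (@derive_val _ _ _ _ _ _ _ dc).
Qed.

Lemma meval_wronskian (K : comNzRingType) (w : 'I_2 -> K)
    (a b f g l f0 f1 g0 g1 : mpoly 2 K) :
  meval w (f * (a * g0 + b * g1) - g * (a * f0 + b * f1) - l * f ^+ 2) =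
  meval w f * (meval w a * meval w g0 + meval w b * meval w g1)
  - meval w g * (meval w a * meval w f0 + meval w b * meval w f1)
  - meval w l * meval w f ^+ 2.
Proof. by rewrite !mevalB !mevalM !mevalD !mevalM. Qed.

(** The logarithmic derivative of [exp (g / f)] is [X (g / f)]; hence
    [f X(g) - g X(f) = L f ^ 2] outside of [f = 0], and everywhere after
    multiplication by [f]. *)
Lemma exponential_factor_equation X f g K L : f != 0 ->
    vf_app X f = K * f ->
    (forall x y : CC R, eval2 f x y != 0 ->
      vf_app_fun X (exp_quot g f) x y / exp_quot g f x y = eval2 L x y) ->
  vf_app X g = K * g + L * f.
Proof.
move=> f0 Xf hL.
have key (w : 'I_2 -> CC R) :
    meval w (f * (f * vf_app X g - g * vf_app X f - L * f ^+ 2)) = 0.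
  pose x := w 0; pose y := w 1.
  have -> : meval w (f * (f * vf_app X g - g * vf_app X f - L * f ^+ 2)) =
      eval2 (f * (f * vf_app X g - g * vf_app X f - L * f ^+ 2)) x y.
    by apply: meval_eq; apply: forall_ord2.
  rewrite /eval2 mevalM; have [->|fn0] := eqVneq (meval (point2 x y) f) 0.
    by rewrite mul0r.
  have := hL x y fn0; rewrite /vf_app_fun /exp_quot /eval2.
  have dx (j : 'I_2) : is_derive x 1 (fun z => point2 z y j) (j == 0)%:R.
    by move: j; apply: forall_ord2; [apply: is_derive_id|apply: is_derive_cst].
  have dy (j : 'I_2) : is_derive y 1 (fun z => point2 x z j) (j == 1)%:R.
    by move: j; apply: forall_ord2; [apply: is_derive_cst|apply: is_derive_id].
  rewrite (derive_exp_quot g dx fn0) (derive_exp_quot g dy fn0).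
  change (fun i => point2 x y i) with (point2 x y).
  rewrite (meval_wronskian (point2 x y)).
  have := cexp_neq0 (meval (point2 x y) g / meval (point2 x y) f).
  move: (cexp _) fn0 => e; move: (meval _ f) (meval _ g) (meval _ X.1) (meval _ X.2)
    (meval _ L) (meval _ (mderiv 0 f)) (meval _ (mderiv 1 f))
    (meval _ (mderiv 0 g)) (meval _ (mderiv 1 g)).
  move=> F G A B l F0 F1 G0 G1 F_n e_n <-.
  by field; rewrite F_n e_n.
have : f * (f * vf_app X g - g * vf_app X f - L * f ^+ 2) == 0.
  by apply/eqP; apply: contrapT => /eqP/mpoly_nonroot[w]; rewrite key eqxx.
rewrite mulf_eq0 (negPf f0) /= Xf => /eqP h0.
apply: (mulfI f0); apply: subr0_eq; rewrite -[RHS]h0; ring.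
Qed.
End ExponentialFactor.

(** * Deformations and geometric multiplicity *)

Section GeometricMultiplicity.
Local Open Scope classical_set_scope.
Variable R : realType.
Implicit Types (X : vfield R) (f g : poly2 R).

Lemma mu_g_ge2 d l0 X f :
  (forall l, (l0 <= l)%N -> approx_by_curves d l X f 2) -> (2%:E <= mu_g d X f)%E.
Proof.
move=> h; rewrite /mu_g; apply: lime_ge.
  apply: ereal_nondecreasing_is_cvgn => l l' ll'.
  apply: ereal_sup_le => _ /= [m [Y [c [h1 h2 h3 h4 h5]]] <-].
  exists m => //; exists Y, c; split=> // k i.
  by have [hi hl] := h3 k i; split=> //; apply: leq_trans hl _.
exists l0 => // l /= /h hl; apply: ereal_sup_ubound.
by exists 2%N.
Qed.

(** Two zeros [k], [k'] would give [(k.+1 - k'.+1) c = 0]. *)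
Lemma eventually_neq0 (K : numFieldType) (c e : K) : c != 0 ->
  exists N, forall k, (N <= k)%N -> c + k.+1%:R^-1 * e != 0.
Proof.
move=> c0; have [[k0 k0E]|nk] := pselect (exists k, c + k.+1%:R^-1 * e = 0); last first.
  by exists 0%N => k _; apply/eqP => ke; apply: nk; exists k.
exists k0.+1 => k kk0; apply/eqP => kE.
have ec j : c + j.+1%:R^-1 * e = 0 -> e = - (j.+1%:R * c).
  have j0 : j.+1%:R != 0 :> K by rewrite pnatr_eq0.
  move=> je; have -> : e = j.+1%:R * (c + j.+1%:R^-1 * e) - j.+1%:R * c by field.
  by rewrite je mulr0 sub0r.
have /eqP := ec _ k0E; rewrite {1}(ec _ kE) eqr_opp => /eqP/(mulIf c0)/eqP.
by rewrite eqr_nat => /eqP[kk]; move: kk0; rewrite kk ltnn.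
Qed.

Lemma cvg_inv_nat (N : nat) : (fun k => ((k + N).+1%:R : CC R)^-1) @ \oo --> (0 : CC R).
Proof.
apply/cvgrPdist_le => -[e e'] /=; rewrite ltcE /= => /andP[/eqP -> e0].
have : harmonic (R := R) @ \oo --> 0 by exact: cvg_harmonic.
move=> /cvgrPdist_le/(_ _ e0) [M _ hM]; exists M => // k /= Mk.
have := hM (k + N)%N (leq_trans Mk (leq_addr _ _)); rewrite /= !sub0r !normrN.
rewrite !ger0_norm ?invr_ge0 ?ler0n // => hk.
have -> : ((k + N).+1%:R : CC R)^-1 = ((k + N).+1%:R^-1 : R)%:C%C.
  by rewrite fmorphV rmorph_nat.
by rewrite lecR.
Qed.

Lemma poly_cvg_perturb (p q : poly2 R) N :
  poly_cvg \oo (fun k => p + ((k + N).+1%:R)^-1 *: q) p.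
Proof.
move=> m; have -> : (fun k => mcoeff m (p + ((k + N).+1%:R)^-1 *: q)) =
    (fun k => mcoeff m p + ((k + N).+1%:R)^-1 * mcoeff m q).
  by apply/funext => k; rewrite mcoeffD mcoeffZ.
rewrite -[X in _ --> X]addr0 -[X in _ + X](mul0r (mcoeff m q)).
by apply: cvgD; [apply: cvg_cst|apply: cvgM; [apply: cvg_inv_nat|apply: cvg_cst]].
Qed.

Lemma poly_cvg_cst (p : poly2 R) : poly_cvg \oo (fun _ : nat => p) p.
Proof. by move=> m; apply: cvg_cst. Qed.

(** A common factor of [f] and [g] divides the Jacobian as well. *)
Lemma common_factor_of_jacobian_unit (K : idomainType) (f g h p q t0 t1 t2 : mpoly 2 K) :
    t0 * f + t1 * g + t2 * (mderiv 0 f * mderiv 1 g - mderiv 1 f * mderiv 0 g) = 1 ->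
  f = h * p -> g = h * q -> (mpoly.msize h <= 1)%N.
Proof.
move=> tJ fE gE; pose r := t0 * p + t1 * q + t2 * (
  mderiv 0 f * mderiv 1 q - mderiv 1 f * mderiv 0 q
  + q * (mderiv 0 p * mderiv 1 h - mderiv 1 p * mderiv 0 h)).
have hr : h * r = 1.
  rewrite -tJ /r fE gE !mderivM; ring.
have h0 : h != 0 by apply: contra_eq_neq hr => ->; rewrite mul0r eq_sym oner_eq0.
have r0 : r != 0 by apply: contra_eq_neq hr => ->; rewrite mulr0 eq_sym oner_eq0.
have := congr1 (fun p => mpoly.msize p) hr; rewrite /= msizeM // msize1.
move: h0 r0; rewrite -!msize_poly_eq0.
by move: (mpoly.msize h) (mpoly.msize r) => m n; lia.
Qed.

(** The coefficient of the leading monomial of [p] survives small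
    perturbations. *)
Lemma msize_perturb (p q : poly2 R) D : mpoly.msize p = D.+1 ->
  exists N, forall k, (N <= k)%N -> (D < mpoly.msize (p + (k.+1%:R)^-1 *: q)%R)%N.
Proof.
move=> sp; have p0 : p != 0 by rewrite -msize_gt0 sp.
have lead0 : mcoeff (mlead p) p != 0 by rewrite mleadc_eq0.
have [N hN] := eventually_neq0 (mcoeff (mlead p) q) lead0.
exists N => k /hN; rewrite -mcoeffZ -mcoeffD -mcoeff_msupp => /msize_mdeg_lt.
by have := mlead_deg p0; rewrite sp => -[->].
Qed.

Lemma vf_degree_perturb d X (z1 z2 : poly2 R) : vf_degree d X ->
    deg_le (Posz d) z1 -> deg_le (Posz d) z2 ->
  exists N, forall k, (N <= k)%N ->
    vf_degree d (X.1 + (k.+1%:R)^-1 *: z1, X.2 + (k.+1%:R)^-1 *: z2).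
Proof.
rewrite /vf_degree => hX d1 d2.
have deg_le_scale (p q : poly2 R) (c : CC R) : (mpoly.msize p <= d.+1)%N ->
    deg_le (Posz d) q -> (mpoly.msize (p + c *: q)%R <= d.+1)%N.
  move=> hp hq; apply: leq_trans (msizeD_le _ _) _; rewrite geq_max hp /=.
  by apply: leq_trans (msizeZ_le _ _) _; rewrite deg_le_nat in hq.
have h1 : (mpoly.msize X.1 <= d.+1)%N by rewrite -hX leq_maxl.
have h2 : (mpoly.msize X.2 <= d.+1)%N by rewrite -hX leq_maxr.
have [e1|e2] : mpoly.msize X.1 = d.+1 \/ mpoly.msize X.2 = d.+1.
  by move: hX; rewrite /maxn; case: ifP => _; [right|left].
- have [N hN] := msize_perturb z1 e1; exists N => k /hN lt /=.
  apply/eqP; rewrite eqn_leq geq_max !deg_le_scale //=.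
  by rewrite leq_max lt.
have [N hN] := msize_perturb z2 e2; exists N => k /hN lt /=.
apply/eqP; rewrite eqn_leq geq_max !deg_le_scale //=.
by rewrite leq_max lt orbT.
Qed.

Lemma smooth_nonsingular f : nonsingular_curve f -> smooth f.
Proof.
move=> ns w; have e2 : w =1 point2 (w 0) (w 1) by apply: forall_ord2.
by rewrite !(meval_eq _ e2); apply: ns.
Qed.

Lemma homogenizeE f D : mpoly.msize f = D.+1 -> homogenize f = hom D f.
Proof. by rewrite /homogenize => ->. Qed.

(** The deformation is [X + e Z] with the curves [f] and [f + e g], where
    [Z = (z1, z2)] and [e] runs through the inverses of large integers. *)
Lemma approx_of_logarithmic d X f g (K L z1 z2 M N : poly2 R) t0 t1 t2 l :
    vf_degree d X -> (1 < mpoly.msize f)%N -> deg_le (Posz d) z1 -> deg_le (Posz d) z2 ->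
    vf_app X f = K * f -> vf_app X g = K * g + L * f ->
    vf_app (z1, z2) f = M * f -> vf_app (z1, z2) g = N * g -> N - M = L ->
    t0 * f + t1 * g + t2 * (mderiv 0 f * mderiv 1 g - mderiv 1 f * mderiv 0 g) = 1 ->
    (mpoly.msize f <= l.+1)%N -> (mpoly.msize g <= l.+1)%N ->
  approx_by_curves d l X f 2.
Proof.
move=> dX sf dz1 dz2 Xf Xg Zf Zg NM tJ fl gl.
have [N1 hN1] := vf_degree_perturb dX dz1 dz2.
have [m fm] : exists m, mpoly.msize f = m.+2.
  by exists (mpoly.msize f).-2; move: sf; case: (mpoly.msize f) => [|[|]].
have [N2 hN2] := msize_perturb g fm.
pose T := maxn N1 N2; pose e k : CC R := ((k + T).+1%:R)^-1.
have T1 k : (N1 <= k + T)%N by rewrite (leq_trans (leq_maxl _ _) (leq_addl _ _)).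
have T2 k : (N2 <= k + T)%N by rewrite (leq_trans (leq_maxr _ _) (leq_addl _ _)).
pose Y k : vfield R := (X.1 + e k *: z1, X.2 + e k *: z2).
pose h k (i : 'I_2) : poly2 R := if i == 0 then f else f + e k *: g.
have YE k p : vf_app (Y k) p = vf_app X p + e k *: vf_app (z1, z2) p.
  rewrite /vf_app /Y /= -!mul_mpolyC; ring.
have e0 k : e k != 0 by rewrite invr_eq0 pnatr_eq0.
exists Y, h; split.
- by move=> k; apply: hN1.
- by split; apply: poly_cvg_perturb.
- move=> k; apply: forall_ord2; rewrite /h /=.
    split=> //; split=> //; exists (K + e k *: M).
    by rewrite YE Xf Zf -!mul_mpolyC; ring.
  split; last first.
    apply: leq_trans (msizeD_le _ _) _; rewrite geq_max fl /=.
    by apply: leq_trans (msizeZ_le _ _) _.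
  split; first by apply: leq_ltn_trans (hN2 _ (T2 k)).
  exists (K + e k *: (M + L)).
  have appD (W : vfield R) p q c : vf_app W (p + c *: q) = vf_app W p + c *: vf_app W q.
    by rewrite /vf_app !mderivD !mderivZ -!mul_mpolyC; ring.
  rewrite appD !YE Xf Xg Zf Zg -NM -!mul_mpolyC; ring.
- have common k (w p q : poly2 R) : f = w * p -> f + e k *: g = w * q ->
      (mpoly.msize w <= 1)%N.
    move=> fw fgw; apply: (common_factor_of_jacobian_unit tJ fw (q := (e k)^-1 *: (q - p))).
    rewrite -scalerAr mulrBr -fw -fgw addrAC subrr add0r scalerA mulVf //.
    by rewrite scale1r.
  move=> k i j; move: i j; apply: forall_ord2; apply: forall_ord2 => //= _ w p q;
    rewrite /h /=; first exact: common.
  by move=> h1 h2; apply: common h2 h1.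
- apply: forall_ord2; rewrite /h /=; first exact: poly_cvg_cst.
  exact: poly_cvg_perturb.
Qed.

End GeometricMultiplicity.

Theorem corollary3 (R : realType) (d : nat) (X : vfield R) (f g : poly2 R)
    (hX : vf_degree d X)
    (hf : invariant_curve X f)
    (hg : is_curve_derivative d X f g)
    (hexp : exponential_factor d X g f)
    (hfsm : nonsingular_curve f)
    (hgsm : nonsingular_curve g)
    (hnc : normal_crossings [:: homogenize f; homogenize g; var3 R 2%:R]) :
  (2%:E <= mu_g d X f)%E.
Proof.
have [f0 [L [sL hL]]] := hexp.
have [sf1 [K Xf]] := hf.
have g0 : g != 0 by have [? [? [? [? [? [_ [_ [_ _ ?]]]]]]]] := hg.
have Xg := exponential_factor_equation f0 Xf hL.
have [m sf] : exists m, mpoly.msize f = m.+2.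
  by exists (mpoly.msize f).-2; move: sf1; case: (mpoly.msize f) => [|[|]].
have [n sg] : exists n, mpoly.msize g = n.+1.
  by exists (mpoly.msize g).-1; rewrite prednK // msize_gt0.
have nc : transverse [:: hom m.+1 f; hom n g; line_at_infinity (CC R)].
  by have := hnc; rewrite (homogenizeE sf) (homogenizeE sg).
have df : deg_le (Posz m.+1) f by rewrite deg_le_nat sf.
have dg : deg_le (Posz n) g by rewrite deg_le_nat sg.
have dX1 : deg_le (Posz d) X.1 by rewrite deg_le_nat -hX leq_maxl.
have dX2 : deg_le (Posz d) X.2 by rewrite deg_le_nat -hX leq_maxr.
have dL : deg_le (Posz d - 1) L by rewrite deg_le_pred_nat.
have dK : deg_le (Posz d - 1) K.
  have sfz : (mpoly.msize f)%:Z = Posz m.+1 + 1 by rewrite sf; clear; lia.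
  apply: (deg_le_cancel sfz) => //; rewrite mulrC -Xf.
  have dfi i : deg_le (Posz m) (mderiv i f) by apply: deg_le_mderivS.
  by apply: deg_leD; [apply: deg_leM dX1 (dfi 0)|apply: deg_leM dX2 (dfi 1)]; clear; lia.
have smf := smooth_nonsingular hfsm; have smg := smooth_nonsingular hgsm.
have [z1 [z2 [M [N [Zf Zg NM dz1 dz2]]]]] :=
  logarithmic_field (pchar_num (CC R)) sf sg smf smg nc Xf Xg dK dX1 dX2 dL.
have [t0 [t1 [t2 tJ]]] := jacobian_unit f0 df dg nc smg.
apply: (mu_g_ge2 (l0 := maxn (mpoly.msize f) (mpoly.msize g))) => l hl.
apply: (approx_of_logarithmic hX sf1 dz1 dz2 Xf Xg Zf Zg NM tJ).
  by apply: leq_trans (leqW hl); apply: leq_maxl.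
by apply: leq_trans (leqW hl); apply: leq_maxr.
Qed.
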